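(* For any hereditary $3$-graph property $\mathcal{H}$, one of the following holds. (1) For all $k\geq 1$, $k\otimes U(k)\in\text{Trip}(\mathcal{H})$. In this case, for some $C,C'>0$, $Tw(\epsilon^{-C})\leq M_{\mathcal{H}}(\epsilon)\leq Tw(\epsilon^{-C'})$ for all sufficiently small $\epsilon>0$. (2) For some $k\geq 1$, $k\otimes U(k)\notin\text{Trip}(\mathcal{H})$. In this case $M^{hom}_{\mathcal H}$ is defined and for some $K>0$, $M_{\mathcal{H}}(\epsilon)\leq M^{hom}_{\mathcal{H}}(\epsilon^4)\leq 2^{2^{\epsilon^{-K}}}$ for all sufficiently small $\epsilon>0$.
   Context: $3$-graphs $H=(V,E)$, $E\subseteq\binom V3$; hereditary $3$-graph properties are classes of finite $3$-graphs closed under isomorphism and induced sub-$3$-graphs. $d_H(X,Y,Z)=|\{(x,y,z)\in X\times Y\times Z:\{x,y,z\}\in E\}|/(|X||Y||Z|)$. A triple $(X,Y,Z)$ is $\epsilon$-regular if $|d_H(X,Y,Z)-d_H(X',Y',Z')|\le\epsilon$ for all subsets $X'\subseteq X,Y'\subseteq Y,Z'\subseteq Z$ of sizes at least $\epsilon|X|,\epsilon|Y|,\epsilon|Z|$; it is $\epsilon$-homogeneous if $d_H(X,Y,Z)\in[0,\epsilon)\cup(1-\epsilon,1]$. A partition $\mathcal P$ of $V$ is $\epsilon$-regular (resp. $\epsilon$-homogeneous) if at least $(1-\epsilon)|V|^3$ triples of $V^3$ lie in $X\times Y\times Z$ for some $\epsilon$-regular (resp. $\epsilon$-homogeneous) $(X,Y,Z)\in\mathcal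 P^3$. $M_{\mathcal H}(\epsilon)$ (resp. $M^{hom}_{\mathcal H}(\epsilon)$) is the least $M$ such that all sufficiently large members of $\mathcal H$ have an $\epsilon$-regular (resp. $\epsilon$-homogeneous) partition with at most $M$ parts; $M^{hom}_{\mathcal H}$ is defined when such $M$ exists for every $\epsilon$. $Tw(1)=1$, $Tw(i)=2^{Tw(i-1)}$. $\text{Trip}(H)$ has vertices $x_v,y_v,z_v$ ($v\in V$) and edges $x_vy_{v'}z_{v''}$ for $vv'v''\in E$; $\text{Trip}(\mathcal H)$ is the closure of $\{\text{Trip}(H):H\in\mathcal H\}$ under isomorphism and induced sub-$3$-graphs. $U(k)$ is the bipartite graph with parts $\{a_1,\dots,a_k\}$, $\{b_S:S\subseteq[k]\}$ and edges $a_ib_S$ for $i\in S$. For a bipartite graph $G=(U\cup V,E)$, $n\otimes G$ is the $3$-graph on $U\cup V\cup\{c_1,\dots,c_n\}$ (new $c_i$) with edges $\{c_i,u,w\}$ for $uw\in E$. *)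

(* Defs.v *)
From HB Require Import structures.
From mathcomp Require Import all_boot all_order all_algebra.
From mathcomp Require Import reals exp Rstruct.
Set Implicit Arguments. Unset Strict Implicit. Unset Printing Implicit Defensive.
Import Order.TTheory GRing.Theory Num.Theory.
Local Open Scope ring_scope.

Notation RR := Rdefinitions.R.

Definition is3graph (V : finType) (E : {set {set V}}) : bool :=
  [forall e in E, #|e| == 3%N].

(* Induced copy of a 3-graph along an injection f : W -> V
   (f injective: an isomorphism onto the induced sub-3-graph on f(W)). *)
Definition pullback (V W : finType) (f : W -> V) (E : {set {set V}})
  : {set {set W}} := [set e : {set W} | f @: e \in E].

Definition prop3 := forall V : finType, {set {set V}} -> Prop.

(* Hereditary: a class of 3-graphs closed under isomorphism and induced
   sub-3-graphs, i.e. under taking induced copies along injections. *)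
Definition hereditary (H : prop3) : Prop :=
  (forall (V : finType) (E : {set {set V}}), H V E -> is3graph E) /\
  (forall (V W : finType) (f : W -> V) (E : {set {set V}}),
      injective f -> H V E -> H W (pullback f E)).

Definition density (V : finType) (E : {set {set V}}) (X Y Z : {set V}) : RR :=
  (#|[set t : V * V * V | [&& t.1.1 \in X, t.1.2 \in Y, t.2 \in Z &
        [set t.1.1; t.1.2; t.2] \in E]]|%:R)
  / ((#|X| * #|Y| * #|Z|)%N%:R).

Definition eps_regular (V : finType) (E : {set {set V}}) (eps : RR)
  (X Y Z : {set V}) : bool :=
  [forall X' : {set V}, forall Y' : {set V}, forall Z' : {set V},
    [&& X' \subset X, Y' \subset Y, Z' \subset Z,
        eps * #|X|%:R <= #|X'|%:R, eps * #|Y|%:R <= #|Y'|%:R &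
        eps * #|Z|%:R <= #|Z'|%:R] ==>
    (`|density E X Y Z - density E X' Y' Z'| <= eps)].

Definition eps_homogeneous (V : finType) (E : {set {set V}}) (eps : RR)
  (X Y Z : {set V}) : bool :=
  (density E X Y Z < eps) || (1 - eps < density E X Y Z).

Definition good_partition (V : finType) (good : {set V} -> {set V} -> {set V} -> bool)
  (eps : RR) (P : {set {set V}}) : bool :=
  partition P [set: V] &&
  ((1 - eps) * (#|V| ^ 3)%N%:R <=
   #|[set t : V * V * V | [exists X in P, exists Y in P, exists Z in P,
        [&& good X Y Z, t.1.1 \in X, t.1.2 \in Y & t.2 \in Z]]]|%:R).

Definition eps_regular_partition (V : finType) (E : {set {set V}}) (eps : RR)
  (P : {set {set V}}) : bool := good_partition (eps_regular E eps) eps P.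

Definition eps_homogeneous_partition (V : finType) (E : {set {set V}}) (eps : RR)
  (P : {set {set V}}) : bool := good_partition (eps_homogeneous E eps) eps P.

Definition reg_bound (H : prop3) (eps : RR) (M : nat) : Prop :=
  exists n0 : nat, forall (V : finType) (E : {set {set V}}),
    H V E -> (n0 <= #|V|)%N ->
    exists P : {set {set V}}, eps_regular_partition E eps P /\ (#|P| <= M)%N.

Definition hom_bound (H : prop3) (eps : RR) (M : nat) : Prop :=
  exists n0 : nat, forall (V : finType) (E : {set {set V}}),
    H V E -> (n0 <= #|V|)%N ->
    exists P : {set {set V}}, eps_homogeneous_partition E eps P /\ (#|P| <= M)%N.

Definition is_MH (H : prop3) (eps : RR) (m : nat) : Prop :=
  reg_bound H eps m /\ forall M, reg_bound H eps M -> (m <= M)%N.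

Definition is_MHhom (H : prop3) (eps : RR) (m : nat) : Prop :=
  hom_bound H eps m /\ forall M, hom_bound H eps M -> (m <= M)%N.

Definition MHhom_defined (H : prop3) : Prop :=
  forall eps : RR, 0 < eps -> exists M, hom_bound H eps M.

(* Tower function: Tw(1) = 1, Tw(i) = 2^Tw(i-1); Tw(0) := 1 by convention. *)
Fixpoint Tw (n : nat) : nat :=
  if n is m.+1 then (if m is 0%N then 1%N else (2 ^ Tw m)%N) else 1%N.

Definition TwR (x : RR) : nat := Tw (Num.truncn x).

(* Trip(H) for a 3-graph on V: vertex x_v = inl (inl v), y_v = inl (inr v),
   z_v = inr v. *)
Definition trip_graph (V : finType) (E : {set {set V}}) : {set {set ((V + V) + V)%type}} :=
  [set e : {set ((V + V) + V)%type} | [exists a : V, exists b : V, exists c : V,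
     ([set a; b; c] \in E) &&
     (e == [set inl (inl a); inl (inr b); inr c])]].

(* Membership in Trip(H): closure of {Trip(H) : H in H} under isomorphism and
   induced sub-3-graphs. *)
Definition in_Trip (H : prop3) (W : finType) (G : {set {set W}}) : Prop :=
  exists (V : finType) (E : {set {set V}}) (f : W -> ((V + V) + V)%type),
    H V E /\ injective f /\ G = pullback f (trip_graph E).

Definition tensor_bip (n : nat) (U V : finType) (r : U -> V -> bool)
  : {set {set ((U + V) + 'I_n)%type}} :=
  [set e : {set ((U + V) + 'I_n)%type} | [exists i : 'I_n, exists u : U, exists w : V,
     r u w && (e == [set inr i; inl (inl u); inl (inr w)])]].

(* U(k): parts {a_1..a_k} and {b_S : S subset [k]}, edges a_i b_S for i in S. *)
Definition U_rel (k : nat) (i : 'I_k) (S : {set 'I_k}) : bool := i \in S.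

Definition kU (k : nat) := tensor_bip k (@U_rel k).

(* Main.v *)
Require Import Defs.
From HB Require Import structures.
From mathcomp Require Import all_boot all_order all_algebra.
From mathcomp Require Import reals exp Rstruct.
From mathcomp Require Import boolp zify ring lra.
Import Order.TTheory GRing.Theory Num.Theory.

(** Tower case.  The upper bound is the energy increment argument.  For the lower
    bound, Trip(H) contains (a large number of copies of a vertex joined to) any
    bipartite graph; take a chain of about [eps^(-1/4)] equal blocks in which the
    classes of block [i] cut block [i+1] in two according to the coordinates of a
    code of exponential size, [phi_i x \in code (phi_(i+1) y)].  If a regular
    partition essentially refines the classes of block [i], then a positive
    proportion of the vertices of block [i+1] in parts mixing several classes would
    produce irregular triples of density [>> s^(-3)]; hence it essentially refines
    block [i+1] as well, with no loss.  The last block has a tower of classes.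

    Homogeneous case.  Double counting shows that for all but few [y] the sets
    [N(y, z) = {x | xyz \in E}], [z] varying, are covered by polynomially many small
    Hamming balls (sampling and Sauer-Shelah).  By symmetry this also holds with [z]
    fixed, so that most balls around [N(y, z)] contain a positive proportion of all
    pairs, and a packing argument covers most of the sets [N(y, z)] by polynomially
    many balls altogether.  Two vertices [x] lying in the same of their centres then
    have almost the same link on average, which makes the corresponding partition
    homogeneous. *)

Set Implicit Arguments. Unset Strict Implicit. Unset Printing Implicit Defensive.
Local Open Scope nat_scope.

(** * The Sauer-Shelah lemma *)

(** In the homogeneous case the covers are local: every [y] has its own few centres, and collecting
    these over all [y] gives a number that grows with [#|V|]. Closeness to many pairs in one
    direction does not help either, since it only yields [r] pairs out of [#|V| ^ 2]. Requiring it
    along the row and then along the columns yields [r ^ 2] pairs, a positive proportion, so that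
    disjointness alone bounds the number of centres.

    In the tower case the distance of the code is what makes an impure part detectable whatever the
    number of classes: different classes of the next block disagree on an eighth of the coordinates,
    so a part mixing them is cut in constant proportions by a constant fraction of the coordinates.
    A block has only a share [1 / r] of the vertices, [r] being linear in the length of the chain.
    This limits the length to less than [eps ^ (-1/3)], and the exponent 1/4 leaves room for the
    constants.

    Passing from Trip(H) back to H loses the tripartition: the images of the three sides may
    overlap, and only crossing triples are under control. Irregular triples are therefore exhibited
    and counted among crossing ones only. *)

Definition shatters (I : finType) (F : {set {set I}}) (A : {set I}) : bool :=
  [forall B : {set I}, (B \subset A) ==> [exists S in F, S :&: A == B]].

Lemma shattersP (I : finType) (F : {set {set I}}) (A : {set I}) :
  reflect (forall B : {set I}, B \subset A -> exists2 S, S \in F & S :&: A = B)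
          (shatters F A).
Proof.
apply: (iffP forallP) => [h B BA | h B].
  by have /implyP/(_ BA)/existsP[S /andP[SF /eqP SA]] := h B; exists S.
apply/implyP => BA; have [S SF SA] := h B BA.
by apply/existsP; exists S; rewrite SF SA eqxx.
Qed.

(* Pajor's strengthening of the Sauer-Shelah lemma: split the family by
   membership of a point that not all sets agree on. *)
Lemma card_le_shattered (I : finType) (F : {set {set I}}) :
  #|F| <= #|[set A | shatters F A]|.
Proof.
have [n] := ubnP #|F|; elim: n => // n IH in F *.
rewrite ltnS => leFn.
have [F1|F2] := leqP #|F| 1.
  have [->|[S SF]] := set_0Vmem F; first by rewrite cards0.
  apply: leq_trans F1 _; apply/card_gt0P; exists set0; rewrite inE.
  apply/shattersP => B; rewrite subset0 => /eqP ->.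
  by exists S => //; rewrite setI0.
have [S [S' [SF S'F neS]]] := card_gt1P F2.
have [x xD] : exists x, (x \in S) != (x \in S').
  apply/existsP; apply: contraR neS; rewrite negb_exists => /forallP h.
  by apply/eqP/setP => y; have := h y; rewrite negbK => /eqP.
pose F1 := [set A in F | x \in A]; pose F0 := [set A in F | x \notin A].
have FE : #|F| = #|F1| + #|F0|.
  rewrite -(cardsID [set A : {set I} | x \in A] F); congr (_ + _);
    by apply: eq_card => A; rewrite !inE // andbC.
have F1_gt0 : 0 < #|F1|.
  apply/card_gt0P; case xS : (x \in S) xD => xS'.
    by exists S; rewrite inE SF.
  by exists S'; rewrite inE S'F; case: (x \in S') xS'.
have F0_gt0 : 0 < #|F0|.
  apply/card_gt0P; case xS : (x \in S) xD => xS'.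
    by exists S'; rewrite inE S'F; case: (x \in S') xS'.
  by exists S; rewrite inE SF xS.
have IH1 : #|F1| <= #|[set A | shatters F1 A]| by apply: IH; lia.
have IH0 : #|F0| <= #|[set A | shatters F0 A]| by apply: IH; lia.
set s1 := [set A | _] in IH1; set s0 := [set A | _] in IH0.
have xs1 A : A \in s1 -> x \notin A.
  rewrite inE => /shattersP h; apply/negP => xA.
  have [T] := h set0 (sub0set _); rewrite inE => /andP[_ xT] /setP/(_ x).
  by rewrite !inE xT xA.
have xs0 A : A \in s0 -> x \notin A.
  rewrite inE => /shattersP h; apply/negP => xA.
  have [T] := h A (subxx _); rewrite inE => /andP[_ /negbTE xT] /setP/(_ x).
  by rewrite !inE xT xA.
(* A set shattered by both halves is counted a second time with [x] added, which makes up for the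
   overlap of [s1] and [s0]. *)
have subU : (s1 :|: s0) :|: [set x |: A | A in s1 :&: s0]
            \subset [set A | shatters F A].
  apply/subsetP => A; rewrite 2!in_setU => /orP[/orP[]|/imsetP[{}A + ->]].
  - rewrite !inE => /shattersP h; apply/shattersP => B /h[T].
    by rewrite inE => /andP[TF _] <-; exists T.
  - rewrite !inE => /shattersP h; apply/shattersP => B /h[T].
    by rewrite inE => /andP[TF _] <-; exists T.
  rewrite in_setI !inE => /andP[/shattersP h1 /shattersP h0].
  apply/shattersP => B; rewrite -subDset => BA.
  have [xB|xB] := boolP (x \in B).
    have [T] := h1 _ BA; rewrite inE => /andP[TF xT] TE; exists T => //.
    by rewrite setIUr TE (setIidPr _) ?sub1set // setD1K.
  have [T] := h0 _ BA; rewrite inE => /andP[TF xT] TE; exists T => //.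
  rewrite setIUr TE; apply/setP => y; rewrite !inE.
  by case: eqP => [->|] /=; rewrite ?(negbTE xT) ?(negbTE xB) // andbF.
apply: leq_trans (subset_leq_card subU).
have dis : [disjoint s1 :|: s0 & [set x |: A | A in s1 :&: s0]].
  rewrite disjoint_sym; apply/pred0P => A /=; apply/negP => /andP[/imsetP[B _ ->]].
  by rewrite inE => /orP[/xs1|/xs0]; rewrite setU11.
rewrite cardsU (disjoint_setI0 dis) cards0 subn0 card_in_imset; last first.
  move=> A B; rewrite !inE => /andP[A1 _] /andP[B1 _] AB.
  have /setU1K <- : x \notin A by apply: xs1; rewrite inE.
  have /setU1K <- : x \notin B by apply: xs1; rewrite inE.
  by rewrite AB.
have := cardsUI s1 s0; lia.
Qed.

(** Padding with [None] encodes a small set as the range of a partial map on ['I_k]; this gives a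
    single power in place of a sum of binomials. *)
Lemma card_small_sets (I : finType) (k : nat) :
  #|[set A : {set I} | #|A| <= k]| <= #|I|.+1 ^ k.
Proof.
pose g (h : {ffun 'I_k -> option I}) : {set I} := [set x | Some x \in codom h].
have -> : #|I|.+1 ^ k = #|{ffun 'I_k -> option I}|.
  by rewrite card_ffun card_option card_ord.
rewrite -cardsT; apply: leq_trans (leq_imset_card g _).
apply: subset_leq_card; apply/subsetP => A; rewrite inE => Ak.
apply/imsetP; exists [ffun i : 'I_k => onth (enum A) i] => //.
apply/setP => x; rewrite inE; apply/idP/codomP => [xA|[i]].
  have lt : index x (enum A) < k.
    by apply: leq_trans Ak; rewrite cardE index_mem mem_enum.
  exists (Ordinal lt); rewrite ffunE /= onthE.
  by rewrite (nth_map x) ?nth_index ?mem_enum // index_mem mem_enum.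
by rewrite ffunE => /esym xE; rewrite -mem_enum; apply/onthP; exists i.
Qed.

Lemma sauer_shelah (I J : finType) (k : nat) (Z : J -> {set I}) :
  injective Z -> #|I|.+1 ^ k < #|J| ->
  exists i : 'I_k -> I, forall S : {set 'I_k}, exists j : J,
    forall a : 'I_k, (i a \in Z j) = (a \in S).
Proof.
move=> Zinj ltJ; set F := Z @: [set: J].
have cF : #|F| = #|J| by rewrite card_imset // cardsT.
have [A shA Ak] : exists2 A, shatters F A & k < #|A|.
  apply/exists_inP; apply: contraTT ltJ; rewrite -leqNgt negb_exists_in => /forall_inP h.
  rewrite -cF; apply: leq_trans (card_le_shattered F) _.
  apply: leq_trans (card_small_sets I k); apply: subset_leq_card.
  by apply/subsetP => A; rewrite !inE => /h; rewrite -leqNgt.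
pose i (a : 'I_k) : I := enum_val (widen_ord (ltnW Ak) a).
have iinj : injective i by move=> a b /enum_val_inj/(congr1 val) /= /val_inj.
exists i => S; have [|T] := (shattersP _ _ shA) (i @: S).
  by apply/subsetP => x /imsetP[a _ ->]; apply: enum_valP.
case/imsetP => j _ -> TE; exists j => a.
by rewrite -(mem_imset S a iinj) -TE inE (enum_valP (widen_ord _ a)) andbT.
Qed.

(** * Links of small VC dimension *)

Lemma card_pairs (S T : finType) (A : {set S}) (B : S -> {set T}) :
  #|[set p : S * T | (p.1 \in A) && (p.2 \in B p.1)]| = \sum_(a in A) #|B a|.
Proof.
rewrite -sum1_card (eq_bigl (fun p : S * T => (p.1 \in A) && (p.2 \in B p.1))).
  rewrite -(pair_big_dep (fun a => a \in A) (fun a b => b \in B a) (fun _ _ => 1)) /=.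
  by apply: eq_bigr => a _; rewrite sum1_card.
by move=> p; rewrite inE.
Qed.

Lemma card_pairs_fst (S T : finType) (R : S -> T -> bool) :
  #|[set p : S * T | R p.1 p.2]| = \sum_a #|[set b | R a b]|.
Proof.
have := card_pairs [set: S] (fun a => [set b | R a b]).
rewrite (eq_bigl predT) => [<-|a]; last by rewrite inE.
by apply: eq_card => p; rewrite !inE.
Qed.

Lemma card_exists_le (S T : finType) (P : S -> T -> bool) :
  #|[set b | [exists a, P a b]]| <= \sum_a #|[set b | P a b]|.
Proof.
have -> : [set b | [exists a, P a b]] = \bigcup_a [set b | P a b].
  apply/setP => b; rewrite inE; apply/existsP/bigcupP => [[a ab]|[a _]].
    by exists a; rewrite ?inE.
  by rewrite inE; exists a.
elim/big_ind2: _ => // [|A m B p Am Bp]; first by rewrite cards0.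
by apply: leq_trans (leq_card_setU _ _) (leq_add _ _).
Qed.

(* Extend a tuple greedily: the next point has at least [#|V| / h] choices. *)
Lemma card_pairwise_far (V : finType) (far : rel V) (h T : nat) :
  (forall W : {set V}, #|W| <= T -> #|V| <= h * #|[set z | [forall w in W, far z w]]|) ->
  forall t, t <= T.+1 -> #|V| ^ t <= h ^ t * #|[set g : t.-tuple V | pairwise far g]|.
Proof.
move=> many; elim=> [_|t IH ltT].
  rewrite !expn0 mul1n; apply/card_gt0P; exists [tuple].
  by rewrite inE.
set A := [set g : t.-tuple V | _] in IH.
pose B (g : t.-tuple V) := [set z | all (far z) g].
have Bge g : #|V| <= h * #|B g|.
  have -> : B g = [set z | [forall w in [set w in g], far z w]].
    apply/setP => z; rewrite !inE; apply/allP/forall_inP => h' w.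
      by rewrite inE => /h'.
    by move=> wg; apply: h'; rewrite inE.
  apply: many; rewrite cardsE (leq_trans (card_size _)) // size_tuple; lia.
pose c (p : t.-tuple V * V) : t.+1.-tuple V := [tuple of p.2 :: p.1].
have cinj : injective c.
  move=> [g z] [g' z'] /(congr1 val) /= [-> gg]; congr (_, _); exact: val_inj.
have /subset_leq_card sub : c @: [set p | (p.1 \in A) && (p.2 \in B p.1)]
     \subset [set g : t.+1.-tuple V | pairwise far g].
  apply/subsetP => _ /imsetP[[g z] + ->].
  by rewrite !inE /= => /andP[-> ->].
rewrite card_imset // card_pairs in sub.
have : #|V| * #|A| <= h * \sum_(g in A) #|B g|.
  rewrite mulnC -sum_nat_const big_distrr /=; exact: leq_sum.
have {}IH := IH (ltnW ltT).
move=> h1; rewrite !expnS.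
apply: leq_trans (leq_mul (leqnn _) IH) _.
rewrite mulnCA [h * h ^ t]mulnC -!mulnA leq_mul //.
by apply: leq_trans h1 _; rewrite leq_mul.
Qed.


Lemma leq_expn_mono (a b m : nat) : a <= b -> a ^ m <= b ^ m.
Proof. by case: m => // m; rewrite leq_exp2r. Qed.

(* Union bound: a random point hits each [d i j] with probability more than [1/s]. *)
Lemma card_separating (V : finType) (s m T : nat) (D : rel 'I_T) (d : 'I_T -> 'I_T -> {set V}) :
  (forall i j, D i j -> #|V| < s * #|d i j|) ->
  2 * T ^ 2 * s.-1 ^ m <= s ^ m ->
  #|V| ^ m <= 2 * #|[set g : {ffun 'I_m -> V} |
     [forall i, forall j, D i j ==> [exists l, g l \in d i j]]]|.
Proof.
move=> dbig sm; set G := [set g | _].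
have cT : #|{: {ffun 'I_m -> V}}| = #|V| ^ m by rewrite card_ffun card_ord.
have GC : #|V| ^ m = #|G| + #|~: G| by rewrite -cT cardsC.
suff : 2 * #|~: G| <= #|V| ^ m by lia.
pose bad (p : 'I_T * 'I_T) (g : {ffun 'I_m -> V}) :=
  D p.1 p.2 && [forall l, g l \notin d p.1 p.2].
have sub : ~: G = [set g | [exists p, bad p g]].
  apply/setP => g; rewrite !inE; apply/idP/existsP.
    move=> /forallPn[i /forallPn[j]]; rewrite negb_imply negb_exists => ?.
    by exists (i, j).
  move=> [[i j]] /= h; apply/forallPn; exists i; apply/forallPn; exists j.
  by rewrite negb_imply negb_exists.
have le1 p : s ^ m * #|[set g | bad p g]| <= s.-1 ^ m * #|V| ^ m.
  rewrite /bad; have [Dp|nDp] /= := boolP (D p.1 p.2); last first.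
    by rewrite (_ : [set g | false] = set0) ?cards0 ?muln0 //; apply/setP => g; rewrite !inE.
  have -> : #|[set g : {ffun 'I_m -> V} | [forall l, g l \notin d p.1 p.2]]|
            = #|~: d p.1 p.2| ^ m.
    rewrite -[in RHS](card_ord m) -card_ffun_on; apply: eq_card => g.
    by rewrite !inE; apply: eq_forallb => l; rewrite inE.
  rewrite -!expnMn leq_expn_mono //.
  have := dbig _ _ Dp; have := cardsC (d p.1 p.2).
  by case: s {sm dbig} => //= s; nia.
have s_gt0 : 0 < s ^ m \/ #|~: G| = 0.
  have [s0|s1] := posnP s; last by left; rewrite expn_gt0 s1.
  right; apply/eqP; rewrite cards_eq0 -subset0; apply/subsetP => g.
  by rewrite sub !inE => /existsP[p /andP[/dbig]]; rewrite s0 mul0n.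
case: s_gt0 => [sm_gt0|->]; last by rewrite muln0.
rewrite -(leq_pmul2l sm_gt0) sub.
apply: leq_trans (_ : 2 * \sum_p s ^ m * #|[set g | bad p g]| <= _).
  by rewrite mulnCA leq_mul // -big_distrr leq_mul // card_exists_le.
apply: leq_trans (_ : 2 * (T ^ 2 * (s.-1 ^ m * #|V| ^ m)) <= _).
  rewrite leq_mul // (leq_trans (leq_sum _ (fun p _ => le1 p))) //.
  by rewrite sum_nat_const card_prod !card_ord -mulnn.
by rewrite !mulnA leq_mul // -[2 * T * T]mulnA.
Qed.

Section Link.
Variables (V : finType) (f : V -> V -> V -> bool).

Definition link_dist (y z z' : V) : nat := #|[set x | f x y z != f x y z']|.

(** All but a fraction [1 / h] of the sets N(y, z) lie in at most [T] Hamming balls of relative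
    radius [1 / s], centred at the N(y, w) with [w] in [W]. *)
Definition coverable (s T h : nat) (y : V) : bool :=
  [exists W : {set V}, (#|W| <= T) &&
     (h * #|[set z | [forall w in W, #|V| < s * link_dist y z w]]| <= #|V|)].

(** Injectivity is asked of [c] alone: the incidences already separate the [a i] and the [b S],
    whereas all the [c j] have the same link. *)
Definition Uconfig (k : nat) : Prop :=
  exists (a : 'I_k -> V) (b : {set 'I_k} -> V) (c : 'I_k -> V),
    injective c /\ forall i S j, f (a i) (c j) (b S) = (i \in S).

(** A [y] that is not coverable admits many [T]-tuples of pairwise far [z], and [m] random [x] give
    these distinct traces. Sauer-Shelah then finds a copy of U(k) inside the sample, located by a
    pattern in [Pi]. One sample with one pattern serves at most [k] vertices [y], as they would form
    the [c j] of a configuration; averaging over the samples leaves a number of such [y] independent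
    of [#|V|]. *)
Lemma few_not_coverable (k m s T h : nat) :
  ~ Uconfig k -> m.+1 ^ k < T -> 2 * T ^ 2 * s.-1 ^ m <= s ^ m ->
  2 * h ^ T.+1 * (k * (m ^ k * T ^ (2 ^ k))) < #|V| ->
  h * #|[set y | ~~ coverable s T h y]| <= #|V|.
Proof.
move=> noU mT sm nbig.
set Y := [set y | _].
pose Pi := ({ffun 'I_k -> 'I_m} * {ffun {set 'I_k} -> 'I_T})%type.
pose X := (T.-tuple V * {ffun 'I_m -> V})%type.
pose pat (pi : Pi) (y : V) (p : X) :=
  [forall i, forall S : {set 'I_k}, f (p.2 (pi.1 i)) y (tnth p.1 (pi.2 S)) == (i \in S)].
have pat_lt pi p : #|[set y in Y | pat pi y p]| <= k.
  rewrite leqNgt; apply/negP => /ltnW ltk; apply: noU.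
  exists (fun i => p.2 (pi.1 i)), (fun S => tnth p.1 (pi.2 S)),
    (fun j => enum_val (widen_ord ltk j)); split.
    by move=> i j /enum_val_inj/(congr1 val) /= /val_inj.
  move=> i S j; have := enum_valP (widen_ord ltk j).
  by rewrite inE => /andP[_ /forallP/(_ i)/forallP/(_ S)/eqP].
have ex_pat y : y \in Y -> #|V| ^ (m + T) <=
    2 * h ^ T * #|[set p : X | [exists pi, pat pi y p]]|.
  rewrite inE negb_exists => /forallP ycov.
  pose far z w := #|V| < s * link_dist y z w.
  have hA : #|V| ^ T <= h ^ T * #|[set g : T.-tuple V | pairwise far g]|.
    apply: (card_pairwise_far (T := T)) => // W WT.
    by move: (ycov W); rewrite WT /= -ltnNge => /ltnW.
  set A := [set g | _] in hA.
  pose d (g : T.-tuple V) (i j : 'I_T) := [set x | f x y (tnth g i) != f x y (tnth g j)].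
  pose B (g : T.-tuple V) := [set x : {ffun 'I_m -> V} |
     [forall i : 'I_T, forall j : 'I_T, (i < j) ==> [exists l, x l \in d g i j]]].
  have hB g : g \in A -> #|V| ^ m <= 2 * #|B g|.
    rewrite inE => gfar.
    apply: (@card_separating V s m T (fun i j => i < j) (d g)) => // i j ij.
    have x0 := tnth_default g i.
    have /(pairwiseP x0)/(_ i j) := gfar; rewrite !inE size_tuple => /(_ (ltn_ord i) (ltn_ord j) ij).
    by rewrite -!tnth_nth.
  have sub : [set p : X | (p.1 \in A) && (p.2 \in B p.1)]
             \subset [set p | [exists pi, pat pi y p]].
    apply/subsetP => -[g x]; rewrite [in X in X -> _]inE /= => /andP[_].
    rewrite [in X in X -> _]inE => /forallP gx.
    pose Z (j : 'I_T) := [set l | f (x l) y (tnth g j)].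
    have Zlt (j j' : 'I_T) : j < j' -> Z j <> Z j'.
      move=> jj'; have /forallP/(_ j')/implyP/(_ jj')/existsP[l] := gx j.
      by rewrite inE => /negP ne /setP/(_ l); rewrite !inE => /eqP.
    have Zinj : injective Z.
      by move=> j j' ZE; apply: val_inj; case: (ltngtP j j') => // /Zlt; case.
    have [|i iP] := @sauer_shelah _ _ k Z Zinj; first by rewrite !card_ord.
    have [b bP] := fin_all_exists iP.
    rewrite inE; apply/existsP; exists (finfun i, finfun b).
    apply/forallP => u; apply/forallP => S; rewrite /= !ffunE.
    by rewrite -(bP S u) inE.
  have := subset_leq_card sub; rewrite card_pairs => sub'.
  have le2 : #|A| * #|V| ^ m <= 2 * \sum_(g in A) #|B g|.
    by rewrite -sum_nat_const big_distrr /=; apply: leq_sum.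
  rewrite expnD.
  apply: leq_trans (leq_mul (leqnn _) hA) _.
  rewrite mulnCA [2 * _]mulnC -mulnA leq_mul // mulnC.
  by apply: leq_trans le2 _; rewrite leq_mul.
have cX : #|{: X}| = #|V| ^ (m + T).
  by rewrite card_prod card_tuple card_ffun card_ord mulnC expnD.
have cPi : #|{: Pi}| = m ^ k * T ^ (2 ^ k).
  by rewrite card_prod !card_ffun !card_ord -cardsT -powersetT card_powerset cardsT card_ord.
have tot : #|Y| * #|V| ^ (m + T) <= 2 * h ^ T * (#|V| ^ (m + T) * (#|{: Pi}| * k)).
  rewrite -sum_nat_const.
  apply: leq_trans (leq_sum _ ex_pat) _; rewrite -big_distrr leq_mul //=.
  apply: leq_trans (leq_sum _ (fun y _ => card_exists_le (fun pi p => pat pi y p))) _.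
  rewrite exchange_big /= -cX mulnCA -sum_nat_const leq_sum // => pi _.
  have -> : \sum_(y in Y) #|[set p | pat pi y p]|
            = \sum_(p : X) #|[set y in Y | pat pi y p]|.
    under eq_bigr do rewrite -sum1dep_card.
    under [RHS]eq_bigr do rewrite -sum1dep_card.
    by rewrite (exchange_big_dep predT).
  by rewrite -sum_nat_const; apply: leq_sum.
rewrite leqNgt; apply/negP => ltn.
have Vpos : 0 < #|V| ^ (m + T) by rewrite expn_gt0; case: #|V| nbig.
move: tot; rewrite [#|V| ^ _ * (_ * _)]mulnC mulnA leq_pmul2r // cPi => le.
have := leq_mul (leqnn h) le; move: nbig ltn; rewrite expnS.
move: (h ^ T) (m ^ k * T ^ (2 ^ k)) => a1 a2; nia.
Qed.
End Link.

Lemma double_count (S T : finType) (A : {set S}) (R : S -> T -> bool) :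
  \sum_(a in A) #|[set b | R a b]| = \sum_b #|[set a in A | R a b]|.
Proof.
under eq_bigr do rewrite -sum1dep_card.
under [RHS]eq_bigr do rewrite -sum1dep_card.
by rewrite (exchange_big_dep predT).
Qed.

Lemma double_countT (S T : finType) (R : S -> T -> bool) :
  \sum_a #|[set b | R a b]| = \sum_b #|[set a | R a b]|.
Proof.
have := double_count [set: S] R; rewrite (eq_bigl predT) => [->|a]; last by rewrite inE.
by apply: eq_bigr => b _; apply: eq_card => a; rewrite !inE.
Qed.

(** Points near a common centre [w] are near each other, so a single light point among them shows
    that they number at most [r]. *)
Lemma card_light (V : finType) (near1 near2 : rel V) (D W : {set V}) (r : nat) :
  (forall w z z', near1 z w -> near1 z' w -> near2 z z') ->
  #|[set z in D | [exists w in W, near1 z w] && (#|[set z' in D | near2 z z']| < r)]|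
    <= #|W| * r.
Proof.
move=> near12; pose L z := #|[set z' in D | near2 z z']| < r.
apply: leq_trans (_ : #|\bigcup_(w in W) [set z in D | near1 z w && L z]| <= _).
  apply: subset_leq_card; apply/subsetP => z; rewrite !inE.
  case/and3P => zD /exists_inP[w wW zw] Lz.
  by apply/bigcupP; exists w; rewrite ?inE ?zD ?zw.
apply: leq_trans (_ : \sum_(w in W) #|[set z in D | near1 z w && L z]| <= _).
  elim/big_ind2: _ => // [|A m B p Am Bp]; first by rewrite cards0.
  by apply: leq_trans (leq_card_setU _ _) (leq_add _ _).
rewrite -sum_nat_const; apply: leq_sum => w _.
have [->|[z]] := set_0Vmem [set z in D | near1 z w && L z]; first by rewrite cards0.
rewrite inE => /and3P[_ zw /ltnW Lz]; apply: leq_trans Lz.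
apply: subset_leq_card; apply/subsetP => z'; rewrite !inE => /and3P[-> z'w _].
exact: near12 zw z'w.
Qed.

(** * Packing the neighbourhoods N(y, z) of pairs *)

Section Fibres.
Variables (V : finType) (f : V -> V -> V -> bool).
Hypothesis fC : forall x y z, f x y z = f x z y.
Variables (s T h : nat).
Local Notation n := #|V|.

Definition fibre_dist (p q : V * V) : nat := #|[set x | f x p.1 p.2 != f x q.1 q.2]|.

Lemma fibre_distC p q : fibre_dist p q = fibre_dist q p.
Proof. by apply: eq_card => x; rewrite !inE eq_sym. Qed.

Lemma fibre_dist_tri p q t : fibre_dist p t <= fibre_dist p q + fibre_dist q t.
Proof.
apply: leq_trans (leq_card_setU _ _); apply: subset_leq_card.
apply/subsetP => x; rewrite !inE.
by case: (f x p.1 p.2); case: (f x q.1 q.2); case: (f x t.1 t.2).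
Qed.

Lemma link_distE y z z' : link_dist f y z z' = fibre_dist (y, z) (y, z').
Proof. by []. Qed.

(** The radius [2 * n / s] is the diameter of a ball of [coverable], so that lying in a common ball
    implies closeness. *)
Definition near_link y z z' := s * link_dist f y z z' <= 2 * n.

Lemma near_link_center y w z z' :
  ~~ (n < s * link_dist f y z w) -> ~~ (n < s * link_dist f y z' w) -> near_link y z z'.
Proof.
rewrite /near_link -!leqNgt !link_distE => h1 h2.
have := fibre_dist_tri (y, z) (y, w) (y, z'); rewrite (fibre_distC (y, w)) => h3.
have := leq_mul (leqnn s) h3; lia.
Qed.

Lemma card_light_link y (D : {set V}) r : coverable f s T h y ->
  h * #|[set z in D | #|[set z' in D | near_link y z z']| < r]| <= n + h * T * r.
Proof.
case/existsP => W /andP[WT hW]; set U := [set z | _] in hW.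
pose near1 z w := ~~ (n < s * link_dist f y z w).
have := @card_light V near1 (near_link y) D W r (@near_link_center y).
set L := [set z in D | _ && _] => leL.
suff : #|[set z in D | #|[set z' in D | near_link y z z']| < r]| <= #|U| + #|L|.
  move=> h1; have := leq_mul (leqnn h) h1; have := leq_mul (leqnn h) leL.
  have := leq_mul (leqnn (h * r)) WT; nia.
apply: leq_trans (_ : #|U :|: L| <= _); last by rewrite cardsU leq_subr.
apply: subset_leq_card.
apply/subsetP => z; rewrite !inE => /andP[-> ->]; rewrite andbT /=.
by rewrite -negb_forall_in orbN.
Qed.

Variable r : nat.
Definition column_heavy y z := r <= #|[set y' | near_link z y y']|.
(** Only column-heavy pairs are counted along the row, so that a step in the row followed by a step
    in a column reaches [r ^ 2] pairs within [(2 + 2) * n / s]. *)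
Definition heavy y z := r <= #|[set z' | column_heavy y z' && near_link y z z']|.
Definition fibre_near (p q : V * V) := s * fibre_dist p q <= 4 * n.

Lemma card_fibre_near y z : heavy y z -> r ^ 2 <= #|[set q | fibre_near (y, z) q]|.
Proof.
pose A := [set z' | column_heavy y z' && near_link y z z'].
move=> hyz; have rA : r <= #|A| := hyz.
pose B z' := [set y' | near_link z' y y'].
pose A' := [set p : V * V | (p.1 \in A) && (p.2 \in B p.1)].
have sub : (fun p : V * V => (p.2, p.1)) @: A' \subset [set q | fibre_near (y, z) q].
  apply/subsetP => _ /imsetP[[z' y'] + ->]; rewrite !inE /= => /andP[/andP[_ h1] h2].
  rewrite /fibre_near; have := fibre_dist_tri (y, z) (y, z') (y', z').
  have -> : fibre_dist (y, z') (y', z') = link_dist f z' y y'.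
    by apply: eq_card => x; rewrite !inE /= !(fC x _ z').
  rewrite -link_distE => h3; have := leq_mul (leqnn s) h3.
  move: h1 h2; rewrite /near_link; lia.
apply: leq_trans (subset_leq_card sub).
rewrite card_imset => [|[? ?] [? ?] [-> ->] //].
rewrite card_pairs -mulnn; apply: leq_trans (_ : #|A| * r <= _).
  by rewrite leq_mul.
by rewrite -sum_nat_const; apply: leq_sum => z'; rewrite !inE => /andP[].
Qed.

(** In a maximal family of heavy pairs at mutual distance above [8 * n / s], the balls of radius
    [4 * n / s] are disjoint and hold at least [r ^ 2] pairs each, while maximality gives the
    covering. *)
Lemma fibre_packing : exists I : {set V * V}, #|I| * r ^ 2 <= n ^ 2 /\
  forall y z, heavy y z -> exists2 q, q \in I & s * fibre_dist (y, z) q <= 8 * n.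
Proof.
pose P (I : {set V * V}) := [forall p in I, heavy p.1 p.2] &&
  [forall p in I, forall q in I, (p != q) ==> (8 * n < s * fibre_dist p q)].
have P0 : P set0 by apply/andP; split; apply/forall_inP => p; rewrite inE.
have [I /maxsetP[/andP[/forall_inP Ih /forall_inP Isep] Imax] _] := maxset_exists P0.
exists I; split.
  have sq : \sum_(p in I) #|[set q | fibre_near p q]| <= n ^ 2.
    rewrite double_count -mulnn -card_prod -sum1_card; apply: leq_sum => q _.
    apply/card_le1P => p; rewrite !inE => /andP[pI pq] p'; rewrite !inE.
    apply/idP/eqP => [/andP[p'I p'q]|-> //]; last by rewrite pI.
    apply/eqP; apply/contraT => ne.
    have /forall_inP/(_ _ pI) := Isep p' p'I; rewrite ne /=.
    have := fibre_dist_tri p' q p; rewrite (fibre_distC q) => h1.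
    have := leq_mul (leqnn s) h1; move: pq p'q; rewrite /fibre_near => a b c.
    by rewrite ltnNge (leq_trans c) // mulnDr (leq_trans (leq_add b a)) // -mulnDl.
  apply: leq_trans sq; rewrite -sum_nat_const; apply: leq_sum => -[y z] /Ih.
  exact: card_fibre_near.
move=> y z hyz.
have [yzI|yzI] := boolP ((y, z) \in I).
  exists (y, z) => //; suff -> : fibre_dist (y, z) (y, z) = 0 by rewrite muln0.
  by apply: eq_card0 => x; rewrite !inE eqxx.
apply/exists_inP; apply: contraNT yzI; rewrite negb_exists_in => /forall_inP far.
rewrite -(Imax ((y, z) |: I)) ?setU11 ?subsetU1 //.
apply/andP; split; first by apply/forall_inP => p; rewrite !inE => /orP[/eqP -> //|/Ih].
apply/forall_inP => p; rewrite !inE => pI; apply/forall_inP => q; rewrite !inE => qI.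
apply/implyP => pq; move: pI qI pq => /orP[/eqP ->|pI] /orP[/eqP ->|qI].
- by rewrite eqxx.
- by rewrite ltnNge far.
- by rewrite fibre_distC ltnNge far.
- by move=> pq; have /forall_inP/(_ _ qI) := Isep p pI; rewrite pq.
Qed.

Hypothesis few : h * #|[set y | ~~ coverable f s T h y]| <= n.

Lemma sum_uncoverable (F : V -> nat) (b : nat) :
  (forall y, F y <= n) -> (forall y, coverable f s T h y -> h * F y <= b) ->
  h * \sum_y F y <= n * n + n * b.
Proof.
move=> Fn Fb; rewrite (bigID (coverable f s T h)) /= mulnDr addnC leq_add //.
  apply: leq_trans (_ : h * (#|[set y | ~~ coverable f s T h y]| * n) <= _).
    rewrite leq_mul // -sum_nat_const; under [X in _ <= X]eq_bigl do rewrite inE.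
    exact: leq_sum.
  by rewrite mulnA leq_mul.
rewrite big_distrr /=; apply: leq_trans (leq_sum _ Fb) _.
by rewrite sum_nat_const leq_mul // max_card.
Qed.

(** A pair that is not heavy is light in its column, or light in its row among the column-heavy
    pairs. After multiplication by [h], each kind costs three times [n ^ 2]: for the lines that are
    not coverable, for the points outside the cover, and for at most [r] light points per centre. *)
Lemma card_not_heavy : h * T * r <= n ->
  h * #|[set p : V * V | ~~ heavy p.1 p.2]| <= 6 * n ^ 2.
Proof.
move=> rn; rewrite (card_pairs_fst (fun y z => ~~ heavy y z)).
pose D y := [set z | column_heavy y z].
have split_heavy y : #|[set z | ~~ heavy y z]| <= #|[set z | ~~ column_heavy y z]| +
    #|[set z in D y | #|[set z' in D y | near_link y z z']| < r]|.
  apply: leq_trans (leq_card_setU _ _); apply: subset_leq_card.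
  apply/subsetP => z; rewrite !inE /heavy -ltnNge => lt.
  case: column_heavy => //=; apply: leq_trans lt; rewrite ltnS.
  by apply: subset_leq_card; apply/subsetP => z'; rewrite !inE.
have h1 : h * \sum_y #|[set z in D y | #|[set z' in D y | near_link y z z']| < r]|
    <= n * n + n * (n + h * T * r).
  by apply: sum_uncoverable => [y|y cy]; [exact: max_card | exact: card_light_link].
have h2 : h * \sum_y #|[set z | ~~ column_heavy y z]| <= n * n + n * (n + h * T * r).
  rewrite double_countT; apply: sum_uncoverable => [y|z cz]; first exact: max_card.
  have := card_light_link [set: V] r cz; apply: leq_trans; rewrite leq_mul //.
  apply: subset_leq_card; apply/subsetP => y; rewrite !inE /column_heavy -ltnNge.
  by apply: leq_trans; rewrite ltnS; apply: subset_leq_card; apply/subsetP => y'; rewrite !inE.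
apply: leq_trans (leq_mul (leqnn h) (leq_sum _ (fun y _ => split_heavy y))) _.
rewrite big_split mulnDr; apply: leq_trans (leq_add h2 h1) _; nia.
Qed.
End Fibres.

Lemma fibre_cover (V : finType) (f : V -> V -> V -> bool) (s T h : nat) :
  (forall x y z, f x y z = f x z y) -> 0 < h * T <= #|V| ->
  h * #|[set y | ~~ coverable f s T h y]| <= #|V| ->
  exists I : {set V * V}, #|I| <= (2 * (h * T)) ^ 2 /\
    h * #|[set p | [forall q in I, 8 * #|V| < s * fibre_dist f p q]]| <= 6 * #|V| ^ 2.
Proof.
move=> fC /andP[hT_gt0 hTn] few; pose r := #|V| %/ (h * T).
have rn : h * T * r <= #|V| by rewrite mulnC leq_trunc_div.
have r_gt0 : 0 < r by rewrite divn_gt0.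
have nr : #|V| <= 2 * (h * T) * r.
  have := ltn_ceil #|V| hT_gt0; rewrite -/r; nia.
have [I [cI Icov]] := fibre_packing fC s r.
exists I; split.
  rewrite -(leq_pmul2r (_ : 0 < r ^ 2)) ?expn_gt0 ?r_gt0 // (leq_trans cI) //.
  by rewrite -expnMn leq_expn_mono.
apply: leq_trans _ (card_not_heavy few rn); rewrite leq_mul //.
apply: subset_leq_card; apply/subsetP => -[y z]; rewrite !inE => /forall_inP far.
by apply/negP => /Icov[q /far]; rewrite ltnNge => /negP.
Qed.

(** * Binary codes *)

Definition hamming (n : nat) (A B : {set 'I_n}) : nat := #|[set i | (i \in A) != (i \in B)]|.

Lemma sum_pow_card (n : nat) : \sum_(D : {set 'I_n}) 4 ^ (n - #|D|) = 5 ^ n.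
Proof.
have -> : 5 ^ n = \prod_(i : 'I_n) (1 + 4) by rewrite prod_nat_const card_ord.
rewrite bigA_distr; apply: eq_bigr => D _.
rewrite (bigID (mem D)) /= big1 => [|i ->] //; rewrite mul1n.
rewrite (eq_bigr (fun=> 4)) => [|i /negbTE -> //].
have -> : n - #|D| = #|~: D| by rewrite -{1}(card_ord n) -(cardsC D) addKn.
by rewrite -prod_nat_const; apply: eq_bigl => i; rewrite inE.
Qed.

(** An exponential moment bound: with the weights [4 ^ (n - #|D|)], of total [5 ^ n], each
    difference set of size at most [d] weighs at least [4 ^ (n - d)]. *)
Lemma card_hamming_ball (n d : nat) (B : {set 'I_n}) :
  #|[set A | hamming A B <= d]| * 4 ^ (n - d) <= 5 ^ n.
Proof.
have -> : #|[set A | hamming A B <= d]| = #|[set D : {set 'I_n} | #|D| <= d]|.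
  pose F (A : {set 'I_n}) := [set i | (i \in A) != (i \in B)].
  have FF : involutive F.
    by move=> A; apply/setP => i; rewrite !inE; case: (i \in A); case: (i \in B).
  rewrite -(card_imset _ (inv_inj FF)); apply: eq_card => D.
  apply/imsetP/idP => [[A + ->]|]; rewrite !inE // => Dd.
  by exists (F D); rewrite ?FF // inE -[hamming _ _]/(#|F (F D)|) FF.
rewrite -sum_pow_card -sum_nat_const [leqRHS](bigID (fun D : {set 'I_n} => #|D| <= d)) /=.
apply: leq_trans (leq_addr _ _).
under eq_bigl do rewrite inE.
by apply: leq_sum => D Dd; rewrite leq_exp2l // leq_sub2l.
Qed.

(** For balls of radius at most [n / 8] the eighth power of the covering inequality is
    [2 ^ (22 * n) <= k ^ 8 * 5 ^ (8 * n)], and this estimate turns it into a code of rate 3/8.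
    Splitting the powers keeps the evaluated numbers small. *)
Lemma pow5_le : 2 ^ 3 * 5 ^ 8 <= 2 ^ 22.
Proof.
have le3 : 5 ^ 3 <= 2 ^ 7 by [].
have le2 : 5 ^ 2 <= 2 ^ 5 by [].
rewrite (expnD 2 3 19); apply: leq_mul; first exact: leqnn.
rewrite (expnD 5 6 2) (expnD 2 14 5); apply: leq_mul; last exact: le2.
by rewrite (expnM 5 3 2) (expnM 2 7 2); exact: leq_expn_mono le3.
Qed.

(* Gilbert-Varshamov: the balls of relative radius 1/8 around a maximal code
   cover the cube. *)
Lemma exists_code (n : nat) : exists (k : nat) (code : 'I_k -> {set 'I_n}),
  [/\ forall u v, u != v -> n <= 8 * hamming (code u) (code v),
      2 ^ (3 * n) <= k ^ 8 & n <= 8 -> k = 2 ^ n].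
Proof.
pose Q (C : {set {set 'I_n}}) :=
  [forall A in C, forall B in C, (A != B) ==> (n <= 8 * hamming A B)].
have Q0 : Q set0 by apply/forall_inP => A; rewrite inE.
have [C /maxsetP[/forall_inP Csep Cmax] _] := maxset_exists Q0.
have hammingC (A B : {set 'I_n}) : hamming A B = hamming B A.
  by apply: eq_card => i; rewrite !inE eq_sym.
(* For positive [n], the largest [d] with [8 * d < n]: a word at distance more than [d] from the
   code could still be added to it. *)
pose d := n.-1 %/ 8.
have cover A : exists2 B, B \in C & hamming A B <= d.
  have h0 : hamming A A = 0 by apply: eq_card0 => i; rewrite !inE eqxx.
  have [AC|AC] := boolP (A \in C); first by exists A; rewrite ?h0.
  apply/exists_inP; apply: contraR AC; rewrite negb_exists_in => /forall_inP far.
  have {}far B : B \in C -> n <= 8 * hamming A B.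
    by move=> /far; rewrite -ltnNge /d ltn_divLR // mulnC; apply: leq_trans; exact: leqSpred.
  rewrite -(Cmax (A |: C)) ?setU11 ?subsetU1 //.
  apply/forall_inP => D; rewrite !inE => DC; apply/forall_inP => D'; rewrite !inE => D'C.
  apply/implyP => DD'; move: DC D'C DD' => /orP[/eqP ->|DC] /orP[/eqP ->|D'C].
  - by rewrite eqxx.
  - by rewrite far.
  - by rewrite hammingC far.
  - by move=> DD'; have /forall_inP/(_ _ D'C) := Csep D DC; rewrite DD'.
have card_cube : #|{set 'I_n}| = 2 ^ n.
  by rewrite -cardsT -powersetT card_powerset cardsT card_ord.
have cubeE : 2 ^ n <= \sum_(B in C) #|[set A | hamming A B <= d]|.
  rewrite double_count -card_cube -sum1_card; apply: leq_sum => A _; apply/card_gt0P.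
  by have [B BC AB] := cover A; exists B; rewrite inE BC.
exists #|C|, (fun i => enum_val i); split=> [u v uv||n8].
- have /forall_inP/(_ _ (enum_valP v)) := Csep _ (enum_valP u).
  by rewrite (inj_eq enum_val_inj) uv.
- have ball : 2 ^ n * 4 ^ (n - d) <= #|C| * 5 ^ n.
    apply: leq_trans (leq_mul cubeE (leqnn _)) _; rewrite big_distrl -sum_nat_const /=.
    by apply: leq_sum => B _; exact: card_hamming_ball.
  have ball8 := leq_expn_mono 8 ball; rewrite !expnMn -!expnM in ball8.
  have p5 : 0 < 5 ^ (n * 8) by rewrite expn_gt0.
  rewrite -(leq_pmul2r p5); apply: leq_trans ball8.
  have -> : 2 ^ (3 * n) * 5 ^ (n * 8) = (2 ^ 3 * 5 ^ 8) ^ n.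
    by rewrite expnMn -!expnM [8 * n]mulnC.
  apply: leq_trans (leq_expn_mono n pow5_le) _.
  rewrite (_ : 4 = 2 ^ 2) // -!expnM -expnD (leq_exp2l _ _ (isT : 1 < 2)).
  have : 8 * d <= n by rewrite mulnC /d; apply: leq_trans (leq_trunc_div _ _) (leq_pred n).
  lia.
(* Here the balls are single words and the code is the whole cube. This starts the chain with the
   exact sizes 1, 2, 4, 16, where the rate 3/8 would give no growth. *)
have d0 : d = 0 by rewrite /d divn_small //; lia.
apply/eqP; rewrite eqn_leq -{1}card_cube max_card /=.
apply: leq_trans cubeE _; rewrite -sum1_card; apply: leq_sum => B _.
rewrite d0 -(cards1 B); apply: subset_leq_card; apply/subsetP => A; rewrite !inE leqn0 cards_eq0.
move=> /eqP/setP h; apply/eqP/setP => i; have := h i.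
by rewrite !inE => /negbFE/eqP.
Qed.

(** * Partitions into colour classes *)

Local Open Scope ring_scope.

Definition fib (V : finType) (T : eqType) (chi : V -> T) (v : V) : {set V} :=
  [set u | chi u == chi v].

Lemma fibE (V : finType) (T : eqType) (chi : V -> T) (u v : V) :
  (u \in fib chi v) = (chi v == chi u).
Proof. by rewrite inE eq_sym. Qed.

(** Indexing by vertices rather than by colours keeps out the empty classes, which [partition]
    forbids. *)
Definition fibres (V : finType) (T : eqType) (chi : V -> T) : {set {set V}} :=
  [set fib chi v | v in [set: V]].

Lemma mem_fib (V : finType) (T : eqType) (chi : V -> T) (v : V) : v \in fib chi v.
Proof. by rewrite inE. Qed.

Lemma fibres_partition (V : finType) (T : eqType) (chi : V -> T) :
  partition (fibres chi) [set: V].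
Proof.
apply/and3P; split.
- apply/eqP/setP => v; rewrite inE; apply/bigcupP.
  by exists (fib chi v); rewrite ?mem_fib // imset_f.
- apply/trivIsetP => _ _ /imsetP[v _ ->] /imsetP[u _ ->] ne.
  apply/pred0P => w /=; apply: contraNF ne; rewrite !inE => /andP[/eqP wv /eqP wu].
  by apply/eqP/setP => w'; rewrite !inE -wv wu.
by apply/imsetP => -[v _ /setP/(_ v)]; rewrite mem_fib inE.
Qed.

Lemma card_fibres (V T : finType) (chi : V -> T) : (#|fibres chi| <= #|T|)%N.
Proof.
rewrite -cardsT; apply: leq_trans (leq_imset_card (fun t => [set u | chi u == t]) _).
apply/subset_leq_card/subsetP => _ /imsetP[v _ ->]; exact: (imset_f _ (in_setT _)).
Qed.

Lemma good_fibres (V : finType) (T : eqType) (chi : V -> T)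
    (good : {set V} -> {set V} -> {set V} -> bool) (eps : RR) :
  #|[set t : V * V * V | ~~ good (fib chi t.1.1) (fib chi t.1.2) (fib chi t.2)]|%:R
    <= eps * (#|V| ^ 3)%N%:R ->
  good_partition good eps (fibres chi).
Proof.
set B := [set t | _] => leB; apply/andP; split; first exact: fibres_partition.
set G := [set t | _].
have sub : ~: B \subset G.
  apply/subsetP => t; rewrite !inE negbK => gt.
  apply/exists_inP; exists (fib chi t.1.1); first exact: imset_f.
  apply/exists_inP; exists (fib chi t.1.2); first exact: imset_f.
  apply/exists_inP; exists (fib chi t.2); first exact: imset_f.
  by rewrite gt !mem_fib.
have leG := subset_leq_card sub; have := cardsC B; 
rewrite !card_prod (_ : (_ * _ * _)%N = (#|V| ^ 3)%N); last by rewrite !expnS muln1 mulnA.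
move=> BC.
apply: le_trans (_ : #|~: B|%:R <= _); last by rewrite ler_nat.
move: leB; rewrite -BC natrD; lra.
Qed.

Lemma card_triples (X Y Z : finType) (P : X -> Y -> Z -> bool) :
  #|[set t : X * Y * Z | P t.1.1 t.1.2 t.2]|%:R
    = \sum_x \sum_y \sum_z (P x y z)%:R :> RR.
Proof.
rewrite pair_bigA pair_bigA /= -sum1dep_card natr_sum big_mkcond /=.
by apply: eq_bigr => t _; case: ifP.
Qed.

Section Averaging.
Variables (V : finType) (T : eqType) (chi : V -> T).

(** The kernel of the conditional expectation onto functions constant on colour classes. Its
    symmetry is what gives [sum_fib_avg] and [fib_avg_selfadj]. *)
Definition fib_weight (u v : V) : RR := (chi u == chi v)%:R / #|fib chi u|%:R.

Lemma fib_card_gt0 v : 0 < #|fib chi v|%:R :> RR.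
Proof. by rewrite ltr0n; apply/card_gt0P; exists v; exact: mem_fib. Qed.

Lemma eq_fib u v : chi u == chi v -> fib chi u = fib chi v.
Proof. by move=> /eqP uv; apply/setP => w; rewrite !inE uv. Qed.

Lemma fib_weightC u v : fib_weight u v = fib_weight v u.
Proof.
rewrite /fib_weight eq_sym; case: eqP => [/eqP/eq_fib -> //|_]; by rewrite !mul0r.
Qed.

Lemma fib_weight_ge0 u v : 0 <= fib_weight u v.
Proof. by rewrite divr_ge0. Qed.

Definition fib_avg (v : V) (F : V -> RR) : RR := \sum_u fib_weight v u * F u.

Lemma fib_avg_cst v (c : RR) : fib_avg v (fun=> c) = c.
Proof.
rewrite /fib_avg -mulr_suml /fib_weight -mulr_suml.
have -> : \sum_u (chi v == chi u)%:R = #|fib chi v|%:R :> RR.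
  rewrite -sum1_card natr_sum [RHS]big_mkcond /=; apply: eq_bigr => u _.
  by rewrite inE eq_sym; case: eqP.
by rewrite divff ?mul1r // gt_eqF ?fib_card_gt0.
Qed.

Lemma fib_avgD v F G : fib_avg v (fun u => F u + G u) = fib_avg v F + fib_avg v G.
Proof. by rewrite -big_split; apply: eq_bigr => u _; rewrite mulrDr. Qed.

Lemma fib_avgB v F G : fib_avg v (fun u => F u - G u) = fib_avg v F - fib_avg v G.
Proof. by rewrite -sumrB; apply: eq_bigr => u _; rewrite mulrBr. Qed.

Lemma le_fib_avg v F G : (forall u, chi u = chi v -> F u <= G u) -> fib_avg v F <= fib_avg v G.
Proof.
move=> FG; apply: ler_sum => u _; have [uv|] := eqVneq (chi v) (chi u).
  by rewrite ler_wpM2l ?fib_weight_ge0 ?FG.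
by rewrite /fib_weight => /negbTE ->; rewrite !mul0r.
Qed.

Lemma sum_fib_avg F : \sum_v fib_avg v F = \sum_v F v.
Proof.
rewrite /fib_avg exchange_big; apply: eq_bigr => u _ /=.
rewrite -mulr_suml; under eq_bigr do rewrite fib_weightC.
by have := fib_avg_cst u 1; rewrite /fib_avg -mulr_suml mulr1 => ->; rewrite mul1r.
Qed.

Lemma eq_fib_avg v F G : F =1 G -> fib_avg v F = fib_avg v G.
Proof. by move=> FG; apply: eq_bigr => u _; rewrite FG. Qed.

Lemma fib_avgE v F : fib_avg v F = (\sum_(u in fib chi v) F u) / #|fib chi v|%:R.
Proof.
rewrite mulr_suml [RHS]big_mkcond; apply: eq_bigr => u _.
rewrite inE /fib_weight eq_sym mulrAC.
by case: eqP; rewrite ?mul1r ?mul0r.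
Qed.

Lemma density_fib_avg (E : {set {set V}}) x y z :
  density E (fib chi x) (fib chi y) (fib chi z) =
  fib_avg x (fun x' => fib_avg y (fun y' => fib_avg z (fun z' =>
     ([set x'; y'; z'] \in E)%:R))).
Proof.
rewrite /density !natrM.
rewrite (card_triples (fun x' y' z' => [&& x' \in fib chi x, y' \in fib chi y,
   z' \in fib chi z & [set x'; y'; z'] \in E])).
rewrite mulr_suml; apply: eq_bigr => x' _; rewrite mulr_suml mulr_sumr.
apply: eq_bigr => y' _; rewrite mulr_suml mulr_sumr mulr_sumr.
apply: eq_bigr => z' _; rewrite !fibE !invfM /fib_weight.
move: (_^-1) (_^-1) (_^-1) => a b c.
by case: (chi x == _); case: (chi y == _); case: (chi z == _); case: (_ \in E);
  rewrite /= ?mul0r ?mulr0 ?mul0r ?mulr0 ?mulr1 ?mul1r // mulrA.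
Qed.
End Averaging.

(** * Homogeneous partitions *)

Definition edge (V : finType) (E : {set {set V}}) (x y z : V) : bool := [set x; y; z] \in E.

Lemma edgeC12 (V : finType) (E : {set {set V}}) x y z : edge E x y z = edge E y x z.
Proof. by rewrite /edge (setUC [set x]). Qed.

Lemma edgeC23 (V : finType) (E : {set {set V}}) x y z : edge E x y z = edge E x z y.
Proof. by rewrite /edge setUAC. Qed.

Lemma sum_rev3 (V : finType) (F : V -> V -> V -> RR) :
  \sum_x \sum_y \sum_z F x y z = \sum_z \sum_y \sum_x F x y z.
Proof.
rewrite exchange_big; under eq_bigr do rewrite exchange_big.
by rewrite exchange_big.
Qed.

(** [B x y z] is the probability that a random triple of the same box disagrees with [(x, y, z)]. By
    [BE] it is [d] or [1 - d], hence at least [eps] unless the box is homogeneous. Changing one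
    coordinate at a time and using the symmetry of [edge] bounds the sum of [B] by three times the
    hypothesis; Markov's inequality concludes. *)
Lemma homogeneous_fibres (V : finType) (T : eqType) (chi : V -> T) (E : {set {set V}})
    (eps delta : RR) :
  0 < eps -> 3%:R * delta <= eps ^+ 2 ->
  \sum_y \sum_z \sum_x fib_avg chi x (fun x' => (edge E x y z != edge E x' y z)%:R)
    <= delta * (#|V| ^ 3)%N%:R ->
  eps_homogeneous_partition E eps (fibres chi).
Proof.
move=> eps_gt0 de; set a := \sum_y _ => a_le.
pose A := fib_avg chi.
pose B x y z := A x (fun x' => A y (fun y' => A z (fun z' =>
  (edge E x y z != edge E x' y' z')%:R))).
pose hom x y z := eps_homogeneous E eps (fib chi x) (fib chi y) (fib chi z).
have BE x y z : B x y z = let d := density E (fib chi x) (fib chi y) (fib chi z) in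
    if edge E x y z then 1 - d else d.
  rewrite /= density_fib_avg /B; case: (edge E x y z); last first.
    by do 3![apply: eq_fib_avg => ?]; rewrite /edge; case: (_ \in E).
  rewrite -[X in _ = X - _](fib_avg_cst chi x 1) -fib_avgB; apply: eq_fib_avg => x'.
  rewrite -[X in _ = X - _](fib_avg_cst chi y 1) -fib_avgB; apply: eq_fib_avg => y'.
  rewrite -[X in _ = X - _](fib_avg_cst chi z 1) -fib_avgB; apply: eq_fib_avg => z'.
  by rewrite /edge; case: (_ \in E); rewrite ?subrr ?subr0.
have B_ge0 x y z : 0 <= B x y z.
  rewrite -(fib_avg_cst chi x 0); apply: le_fib_avg => x' _.
  rewrite -(fib_avg_cst chi y 0); apply: le_fib_avg => y' _.
  by rewrite -(fib_avg_cst chi z 0); apply: le_fib_avg => z' _.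
have Bnot x y z : eps * (~~ hom x y z)%:R <= B x y z.
  have [|] := boolP (hom x y z); rewrite ?mulr0 ?B_ge0 //= mulr1.
  rewrite BE /= /hom /eps_homogeneous negb_or -!leNgt => /andP[h1 h2].
  by case: edge => //; lra.
have sumB : \sum_x \sum_y \sum_z B x y z <= a + a + a.
  pose A1 x y z := A x (fun x' => (edge E x y z != edge E x' y z)%:R).
  pose A2 x y z := A x (fun x' => A y (fun y' => (edge E x' y z != edge E x' y' z)%:R)).
  pose A3 x y z := A x (fun x' => A y (fun y' => A z (fun z' =>
     (edge E x' y' z != edge E x' y' z')%:R))).
  have B3 x y z : B x y z <= A1 x y z + A2 x y z + A3 x y z.
    rewrite -!fib_avgD; apply: le_fib_avg => x' _.
    rewrite -[X in _ <= X + _ + _](fib_avg_cst chi y) -!fib_avgD; apply: le_fib_avg => y' _.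
    rewrite -[X in _ <= X + _](fib_avg_cst chi z) -!fib_avgD; apply: le_fib_avg => z' _.
    rewrite -!natrD ler_nat.
    by case: (edge E x y z); case: (edge E x' y z); case: (edge E x' y' z); case: (edge E x' y' z').
  apply: le_trans (_ : \sum_x \sum_y \sum_z (A1 x y z + A2 x y z + A3 x y z) <= _).
    by do 3![apply: ler_sum => ? _].
  under eq_bigr do under eq_bigr do rewrite !big_split.
  under eq_bigr do rewrite !big_split; rewrite !big_split /=.
  rewrite lerD ?lerD //.
  - by rewrite exchange_big; apply: ler_sum => y _; rewrite exchange_big.
  - rewrite le_eqVlt; apply/orP; left; apply/eqP.
    transitivity (\sum_y \sum_z \sum_x A y (fun y' => (edge E x y z != edge E x y' z)%:R)).
      rewrite exchange_big; apply: eq_bigr => y _; rewrite exchange_big; apply: eq_bigr => z _.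
      by rewrite /A2 /A sum_fib_avg.
    rewrite exchange_big [RHS]exchange_big; apply: eq_bigr => z _; rewrite exchange_big.
    apply: eq_bigr => x _; apply: eq_bigr => y _; apply: eq_fib_avg => y'.
    by rewrite !(edgeC12 E x).
  rewrite le_eqVlt; apply/orP; left; apply/eqP.
  transitivity (\sum_x \sum_y \sum_z A z (fun z' => (edge E x y z != edge E x y z')%:R)).
    rewrite [LHS]sum_rev3 [RHS]sum_rev3; apply: eq_bigr => z _.
    under eq_bigr do rewrite /A3 /A sum_fib_avg.
    by rewrite [LHS]exchange_big [RHS]exchange_big; apply: eq_bigr => x _; rewrite sum_fib_avg.
  apply: eq_bigr => y _; apply: eq_bigr => z _; apply: eq_bigr => x _; apply: eq_fib_avg => x'.
  by rewrite !(edgeC23 E y z) !(edgeC12 E y).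
apply: good_fibres.
rewrite (card_triples (fun x y z => ~~ hom x y z)).
rewrite -(ler_pM2l eps_gt0); apply: le_trans (_ : a + a + a <= _).
  apply: le_trans sumB; rewrite !mulr_sumr; apply: ler_sum => x _.
  rewrite !mulr_sumr; apply: ler_sum => y _.
  by rewrite !mulr_sumr; apply: ler_sum => z _.
have n0 : 0 <= (#|V| ^ 3)%N%:R :> RR by [].
have := ler_wpM2r n0 de; move: a_le; rewrite expr2; lra.
Qed.

(** * From a missing [kU k] to homogeneous partitions *)

Lemma in_Trip_Uconfig (H : prop3) (V : finType) (E : {set {set V}}) (k : nat) :
  (1 <= k)%N -> H V E -> Uconfig (edge E) k -> in_Trip H (kU k).
Proof.
move=> k_gt0 HE [a [b [c [cinj abc]]]].
pose F (w : ('I_k + {set 'I_k}) + 'I_k) : (V + V) + V :=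
  match w with inl (inl i) => inl (inl (a i)) | inl (inr B) => inl (inr (b B))
             | inr j => inr (c j) end.
have Finj : injective F.
  have j0 : 'I_k by exists 0%N.
  move=> [[i|B]|j] [[i'|B']|j'] //= [].
  - by move=> ai; have := abc i [set i'] j0; rewrite ai abc !inE eqxx => /esym/eqP ->.
  - move=> bB; congr (inl (inr _)); apply/setP => i.
    by rewrite -(abc i B j0) bB abc.
  - by move=> /cinj ->.
exists V, E, F; split=> //; split=> //; apply/setP => e; rewrite !inE.
apply/existsP/existsP => [[j /existsP[i /existsP[B /andP[iS /eqP ->]]]]|].
  exists (a i); apply/existsP; exists (b B); apply/existsP; exists (c j).
  have := abc i B j; rewrite /edge setUAC => ->; rewrite [_ \in _]iS /=.
  by rewrite !imsetU !imset_set1 /= -setUA setUC.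
move=> [u /existsP[v /existsP[w /andP[uvw /eqP Fe]]]].
have /imsetP[w1 _ w1E] : inl (inl u) \in F @: e by rewrite Fe !inE eqxx.
have /imsetP[w2 _ w2E] : inl (inr v) \in F @: e by rewrite Fe !inE eqxx orbT.
have /imsetP[w3 _ w3E] : inr w \in F @: e by rewrite Fe !inE eqxx orbT.
case: w1 w2 w3 w1E w2E w3E => [[i|//]|//] [[//|B]|//] [[//|//]|j] [uE] [vE] [wE].
exists j; apply/existsP; exists i; apply/existsP; exists B.
rewrite /U_rel -(abc i B j) /edge -uE -vE -wE setUAC uvw /=.
apply/eqP/(imset_inj Finj); rewrite Fe !imsetU !imset_set1 /= -uE -vE -wE.
by rewrite setUC setUA.
Qed.

Lemma expn_le_exp2 (K : nat) : exists s0 : nat, forall s : nat, (s0 <= s)%N -> (s ^ K <= 2 ^ s)%N.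
Proof.
exists (2 ^ (4 * K + 2))%N => s les.
have s_gt0 : (0 < s)%N by apply: leq_trans les; rewrite expn_gt0.
set l := trunc_log 2 s.
have ls : (2 ^ l <= s)%N by rewrite trunc_logP.
have sl : (s < 2 ^ l.+1)%N by rewrite trunc_log_ltn.
have lK : (4 * K + 2 <= l)%N by rewrite -ltnS -(@ltn_exp2l 2) // (leq_ltn_trans les).
apply: leq_trans (leq_expn_mono K (ltnW sl)) _; rewrite -expnM leq_exp2l //.
apply: leq_trans ls; rewrite -(odd_double_half l) expnD.
have := ltn_expl l./2 (isT : 1 < 2)%N; set j := l./2.
rewrite -addnn expnD => jl.
have jK : (2 * K <= j)%N by rewrite /j; lia.
have h1 : (l < 2 * j.+1)%N by rewrite /j; lia.
have h2 : (1 <= 2 ^ odd l)%N by rewrite expn_gt0.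
have h3 : (j.+1 * j.+1 <= 2 ^ j * 2 ^ j)%N by rewrite leq_mul.
have h4 : ((odd l + (j + j)).+1 * K <= j.+1 * j.+1)%N by move: (leq_b1 (odd l)); nia.
by apply: leq_trans h4 (leq_trans h3 _); rewrite leq_pmull.
Qed.

Lemma two_pred_expn (s : nat) : (0 < s)%N -> (2 * s.-1 ^ s <= s ^ s)%N.
Proof.
case: s => // s _ /=.
suff bern t : (t * s ^ t.-1 + s ^ t <= s.+1 ^ t)%N.
  apply: leq_trans (bern s.+1); rewrite /= mul2n -addnn leq_add2r.
  by rewrite expnS leq_mul.
elim: t => [|[|t] IH] //.
rewrite [in leqRHS]expnS; apply: leq_trans (leq_mul (leqnn s.+1) IH).
rewrite /= !expnS; move: (s ^ t)%N => a; nia.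
Qed.

(** The choice is [h = s], a sample of [m = s * s] points, and [T] just above the Sauer-Shelah
    threshold [(m + 1) ^ k]. Since [(1 - 1/s) ^ (s * s)] is at most [2 ^ (- s)] and [T] is
    polynomial in [s], both inequalities hold eventually. Bounding the number of centres by [2 ^ s]
    hides a polynomial whose degree depends on [k]. *)
Lemma fibre_parameters (k : nat) : exists s0 : nat, forall s : nat, (s0 <= s)%N ->
  let T := ((s * s).+1 ^ k).+1 in
  (2 * T ^ 2 * s.-1 ^ (s * s) <= s ^ (s * s))%N /\ ((2 * (s * T)) ^ 2 <= 2 ^ s)%N.
Proof.
have [s0 s0P] := expn_le_exp2 (6 * k + 6).
exists (s0 + 2)%N => s les T.
have s2 : (2 <= s)%N by lia.
have s_gt0 : (0 < s)%N by lia.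
have Ts : (T <= s ^ (3 * k).+1)%N.
  apply: leq_trans (_ : (s ^ 3) ^ k + 1 <= _)%N; last first.
    rewrite -expnM expnS; apply: leq_trans (_ : 2 * s ^ (3 * k) <= _)%N; last by rewrite leq_mul.
    by rewrite mul2n -addnn leq_add2l expn_gt0 s_gt0.
  by rewrite addn1 ltnS leq_expn_mono // !expnS expn0; nia.
have sK : ((2 * (s * T)) ^ 2 <= 2 ^ s)%N.
  apply: leq_trans (_ : (s ^ (3 * k + 3)) ^ 2 <= _)%N.
    rewrite leq_expn_mono // (_ : 3 * k + 3 = (3 * k).+3)%N; last by lia.
    by rewrite 2!expnS leq_mul // leq_mul.
  by rewrite -expnM (_ : (3 * k + 3) * 2 = 6 * k + 6)%N; [apply: s0P | ]; lia.
split=> //; rewrite [in leqRHS]expnM.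
apply: leq_trans (leq_expn_mono s (two_pred_expn s_gt0)).
rewrite expnMn -expnM leq_mul //; apply: leq_trans sK.
rewrite !expnMn; move: (T ^ 2)%N => T2; nia.
Qed.

(** Its classes are the atoms generated by the centres N(q), [q] in [I]. *)
Definition fibre_trace (V : finType) (E : {set {set V}}) (I : {set V * V}) (x : V) :
  {set V * V} := [set q in I | edge E x q.1 q.2].

Lemma card_fibre_trace (V : finType) (E : {set {set V}}) (I : {set V * V}) :
  (#|fibres (fibre_trace E I)| <= 2 ^ #|I|)%N.
Proof.
rewrite -card_powerset.
apply: leq_trans (leq_imset_card (fun t => [set u | fibre_trace E I u == t]) _).
apply/subset_leq_card/subsetP => _ /imsetP[v _ ->]; apply: imset_f.
by rewrite powersetE; apply/subsetP => q; rewrite inE => /andP[].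
Qed.

(** Vertices of equal trace agree on [q], so a disagreement at [(y, z)] puts [x] or [x'] into the
    symmetric difference of N(y, z) and N(q). Averaging preserves sums, so the two cases cost the
    same: hence the factor 2. *)
Lemma sum_avg_fibre_trace (V : finType) (E : {set {set V}}) (I : {set V * V}) (q : V * V) y z :
  q \in I ->
  \sum_x fib_avg (fibre_trace E I) x (fun x' => (edge E x y z != edge E x' y z)%:R)
    <= (2 * fibre_dist (edge E) (y, z) q)%N%:R.
Proof.
move=> qI; pose D x : RR := (edge E x y z != edge E x q.1 q.2)%:R.
have sumD : \sum_x D x = (fibre_dist (edge E) (y, z) q)%:R.
  rewrite /fibre_dist -sum1dep_card natr_sum [RHS]big_mkcond; apply: eq_bigr => x _.
  by rewrite /D /=; case: eqP.
apply: le_trans (_ : \sum_x fib_avg (fibre_trace E I) x (fun x' => D x + D x') <= _).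
  apply: ler_sum => x _; apply: le_fib_avg => x' /setP/(_ q).
  rewrite !inE qI /= /D -natrD ler_nat => <-.
  by case: (edge E x y z); case: (edge E x' y z); case: (edge E x' q.1 q.2).
under eq_bigr do rewrite fib_avgD fib_avg_cst.
by rewrite big_split /= sum_fib_avg sumD mul2n -addnn natrD.
Qed.

Lemma sum_avg_le (V : finType) (T : eqType) (chi : V -> T) (E : {set {set V}}) y z :
  \sum_x fib_avg chi x (fun x' => (edge E x y z != edge E x' y z)%:R) <= #|V|%:R.
Proof.
rewrite -sum1_card natr_sum; apply: ler_sum => x _.
rewrite -[leRHS](fib_avg_cst chi x); apply: le_fib_avg => x' _.
by rewrite ler_nat leq_b1.
Qed.

(** A covered pair costs [2 * 8], the uncovered pairs together cost 6, and [homogeneous_fibres]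
    multiplies the total 22 by 3. *)
Lemma homogeneous_fibre_trace (V : finType) (E : {set {set V}}) (I : {set V * V}) (s : nat)
    (eps : RR) : 0 < eps -> 66%:R <= s%:R * eps ^+ 2 ->
  (s * #|[set p | [forall q in I, 8 * #|V| < s * fibre_dist (edge E) p q]]| <= 6 * #|V| ^ 2)%N ->
  eps_homogeneous_partition E eps (fibres (fibre_trace E I)).
Proof.
move=> eps_gt0 seps; set far := [set p | _] => farle.
have s_gt0 : 0 < s%:R :> RR by nra.
apply: (@homogeneous_fibres _ _ _ _ _ (22%:R / s%:R)) => //.
  rewrite mulrA ler_pdivrMr //; move: seps; rewrite mulrC; lra.
rewrite mulrAC ler_pdivlMr //.
pose S y z := \sum_x fib_avg (fibre_trace E I) x (fun x' => (edge E x y z != edge E x' y z)%:R).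
pose n : RR := #|V|%:R.
have Sle y z : s%:R * S y z <= 16%:R * n + s%:R * n * ((y, z) \in far)%:R.
  have [yz|yz] := boolP ((y, z) \in far).
    rewrite mulr1; have := sum_avg_le (fibre_trace E I) E y z; rewrite -/(S y z) => h1.
    have n0 : 0 <= n by []. have := ler_wpM2l (ltW s_gt0) h1; rewrite -/n; lra.
  rewrite mulr0 addr0; move: yz; rewrite inE negb_forall_in => /exists_inP[q qI].
  rewrite -leqNgt => h1; have h2 := sum_avg_fibre_trace E y z qI.
  apply: le_trans (ler_wpM2l (ltW s_gt0) h2) _.
  by rewrite -!natrM ler_nat mulnCA (leq_trans (leq_mul (leqnn 2) h1)) // mulnA.
apply: le_trans (_ : \sum_y \sum_z (16%:R * n + s%:R * n * ((y, z) \in far)%:R) <= _).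
  rewrite mulr_suml; apply: ler_sum => y _; rewrite mulr_suml; apply: ler_sum => z _.
  by rewrite mulrC; exact: Sle.
have sumfar : \sum_y \sum_z ((y, z) \in far)%:R = #|far|%:R :> RR.
  rewrite pair_bigA /= -sum1_card natr_sum [RHS]big_mkcond /=.
  by apply: eq_bigr => -[y z] _; case: (_ \in _).
have -> : \sum_y \sum_z (16%:R * n + s%:R * n * ((y, z) \in far)%:R)
    = 16%:R * n * n * n + s%:R * n * #|far|%:R.
  rewrite -sumfar mulr_sumr; under eq_bigr do rewrite big_split /= -mulr_sumr sumr_const.
  have nE (c : RR) : c *+ #|V| = c * n by rewrite mulr_natr.
  rewrite big_split /= sumr_const !nE !mulrA; congr (_ + _).
  by apply: eq_bigr => y _; rewrite mulr_sumr.
rewrite natrX -/n.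
have := farle; rewrite -(ler_nat RR) !natrM ?natrX -/n => h1.
have n0 : 0 <= n by [].
have := ler_wpM2r n0 h1; rewrite !exprS expr0; lra.
Qed.

Lemma hom_bound_of_notin_Trip (H : prop3) (k : nat) :
  (1 <= k)%N -> ~ in_Trip H (kU k) ->
  exists s0 : nat, forall (s : nat) (eps : RR), (s0 <= s)%N -> 0 < eps ->
    66%:R <= s%:R * eps ^+ 2 -> hom_bound H eps (2 ^ (2 ^ s)).
Proof.
move=> k_gt0 noU; have [s0 s0P] := fibre_parameters k.
exists s0 => s eps s0s eps_gt0 seps.
have s_gt0 : (0 < s)%N by case: s seps {s0s} => //; rewrite mul0r; lra.
have [Tm Ts] := s0P s s0s; set T := ((s * s).+1 ^ k).+1 in Tm Ts.
exists (2 * s ^ T.+1 * (k * ((s * s) ^ k * T ^ (2 ^ k))) + s * T).+1 => V E HE nbig.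
have noC : ~ Uconfig (edge E) k by move=> /(in_Trip_Uconfig k_gt0 HE).
have few : (s * #|[set y | ~~ coverable (edge E) s T s y]| <= #|V|)%N.
  apply: (few_not_coverable noC (ltnSn _) Tm); apply: leq_trans nbig.
  by rewrite ltnS leq_addr.
have sT : (0 < s * T <= #|V|)%N.
  by rewrite muln_gt0 s_gt0 /=; apply: leq_trans nbig; rewrite ltnW // ltnS leq_addl.
have [I [cI Ifar]] := fibre_cover (edgeC23 E) sT few.
exists (fibres (fibre_trace E I)); split; first exact: (@homogeneous_fibre_trace _ _ _ s).
by apply: leq_trans (card_fibre_trace E I) _; rewrite leq_exp2l // (leq_trans cI).
Qed.

(** * From homogeneous to regular partitions *)

Definition box (V : finType) (X Y Z : {set V}) : {set V * V * V} :=
  [set t : V * V * V | [&& t.1.1 \in X, t.1.2 \in Y & t.2 \in Z]].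

Definition edges_in (V : finType) (E : {set {set V}}) (X Y Z : {set V}) : {set V * V * V} :=
  [set t in box X Y Z | edge E t.1.1 t.1.2 t.2].

Lemma mem_edges_in (V : finType) (E : {set {set V}}) (X Y Z : {set V}) t :
  (t \in edges_in E X Y Z) = (t \in box X Y Z) && edge E t.1.1 t.1.2 t.2.
Proof. by rewrite inE. Qed.

Lemma card_box (V : finType) (X Y Z : {set V}) : #|box X Y Z| = (#|X| * #|Y| * #|Z|)%N.
Proof. by rewrite -!cardsX; apply: eq_card => -[[x y] z]; rewrite !inE /= andbA. Qed.

Lemma densityE (V : finType) (E : {set {set V}}) (X Y Z : {set V}) :
  density E X Y Z = #|edges_in E X Y Z|%:R / #|box X Y Z|%:R.
Proof.
rewrite /density card_box; congr (_%:R / _).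
by apply: eq_card => t; rewrite !inE -!andbA.
Qed.

Lemma subset_box (V : finType) (X Y Z X' Y' Z' : {set V}) :
  X' \subset X -> Y' \subset Y -> Z' \subset Z -> box X' Y' Z' \subset box X Y Z.
Proof.
move=> /subsetP sX /subsetP sY /subsetP sZ; apply/subsetP => t.
by rewrite !inE => /and3P[/sX -> /sY -> /sZ ->].
Qed.

Lemma card_box_ge (V : finType) (eps : RR) (X Y Z X' Y' Z' : {set V}) : 0 <= eps ->
  eps * #|X|%:R <= #|X'|%:R -> eps * #|Y|%:R <= #|Y'|%:R -> eps * #|Z|%:R <= #|Z'|%:R ->
  eps ^+ 3 * #|box X Y Z|%:R <= #|box X' Y' Z'|%:R.
Proof.
move=> e0 hX hY hZ; rewrite !card_box !natrM !exprS expr0 mulr1.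
have hXY : (eps * #|X|%:R) * (eps * #|Y|%:R) <= #|X'|%:R * #|Y'|%:R.
  by rewrite ler_pM // mulr_ge0.
have : (eps * #|X|%:R) * (eps * #|Y|%:R) * (eps * #|Z|%:R) <= #|X'|%:R * #|Y'|%:R * #|Z'|%:R.
  by rewrite ler_pM // !mulr_ge0.
by apply: le_trans; rewrite le_eqVlt; apply/orP; left; apply/eqP; ring.
Qed.

(** A sub-box tested by regularity fills at least [eps ^ 3] of the box, so a density below [eps ^ 4]
    stays below [eps] on it. For densities near 1 the same argument is applied to the non-edges. *)
Lemma regular_of_homogeneous (V : finType) (E : {set {set V}}) (eps : RR) (X Y Z : {set V}) :
  0 < eps <= 1 -> (0 < #|X|)%N -> (0 < #|Y|)%N -> (0 < #|Z|)%N ->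
  eps_homogeneous E (eps ^+ 4) X Y Z -> eps_regular E eps X Y Z.
Proof.
move=> /andP[e0 e1] X0 Y0 Z0 hom; apply/forallP => X'; apply/forallP => Y'; apply/forallP => Z'.
apply/implyP => /and5P[sX sY sZ hX /andP[hY hZ]].
rewrite -(ltr_nat RR) in X0; rewrite -(ltr_nat RR) in Y0; rewrite -(ltr_nat RR) in Z0.
have sB := subset_box sX sY sZ.
have B'_ge := card_box_ge (ltW e0) hX hY hZ.
have B0 : 0 < #|box X Y Z|%:R :> RR by rewrite card_box !natrM !mulr_gt0.
have B'0 : 0 < #|box X' Y' Z'|%:R :> RR by apply: lt_le_trans B'_ge; rewrite mulr_gt0 ?exprn_gt0.
have sE : edges_in E X' Y' Z' \subset edges_in E X Y Z.
  by apply/subsetP => t; rewrite !inE -!andbA => /and4P[/(subsetP sX) -> /(subsetP sY) -> /(subsetP sZ) -> ->].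
have sF : box X' Y' Z' :\: edges_in E X' Y' Z' \subset box X Y Z :\: edges_in E X Y Z.
  apply/subsetP => t; rewrite !in_setD => /andP[nE tB].
  rewrite (subsetP sB) // andbT; move: nE; rewrite !mem_edges_in tB (subsetP sB) //.
have cF A B C : #|box A B C :\: edges_in E A B C|%:R = #|box A B C|%:R - #|edges_in E A B C|%:R :> RR.
  rewrite cardsD (setIidPr _) ?natrB ?subset_leq_card //;
    by apply/subsetP => t; rewrite inE => /andP[].
move: (subset_leq_card sE) (subset_leq_card sF); rewrite -!(ler_nat RR) !cF.
move: hom; rewrite /eps_homogeneous !densityE ltr_pdivrMr // ltr_pdivlMr //.
have E0 : 0 <= #|edges_in E X Y Z|%:R :> RR by [].
have E'0 : 0 <= #|edges_in E X' Y' Z'|%:R :> RR by [].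
have F0 : 0 <= #|box X Y Z|%:R - #|edges_in E X Y Z|%:R :> RR by rewrite -cF.
have F'0 : 0 <= #|box X' Y' Z'|%:R - #|edges_in E X' Y' Z'|%:R :> RR by rewrite -cF.
move: E0 E'0 F0 F'0 B'_ge B0 B'0.
move: (#|edges_in E X Y Z|%:R) (#|edges_in E X' Y' Z'|%:R) => e e'.
move: (#|box X Y Z|%:R) (#|box X' Y' Z'|%:R) => b b' E0 E'0 F0 F'0 B'_ge B0 B'0 hom ee' ff'.
have e4 : eps ^+ 4 * b <= eps * b'.
  by rewrite exprS -mulrA ler_pM2l.
have e4' : eps ^+ 4 <= eps by rewrite exprS ler_piMr ?exprn_ile1 // ltW.
rewrite ler_norml; apply/andP.
case/orP: hom => hom.
  have d0 : 0 <= e / b by rewrite divr_ge0 // ltW.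
  have d1 : e / b <= eps by rewrite ler_pdivrMr //; apply: le_trans (ltW hom) _; rewrite ler_pM2r.
  have d0' : 0 <= e' / b' by rewrite divr_ge0 // ltW.
  have d1' : e' / b' <= eps by rewrite ler_pdivrMr //; lra.
  by split; lra.
have d0 : e / b <= 1 by rewrite ler_pdivrMr // mul1r -subr_ge0.
have d1 : 1 - eps <= e / b by rewrite ler_pdivlMr //; nra.
have d0' : e' / b' <= 1 by rewrite ler_pdivrMr // mul1r -subr_ge0.
have d1' : 1 - eps <= e' / b' by rewrite ler_pdivlMr //; lra.
by split; lra.
Qed.

Lemma good_partition_mono (V : finType) (g g' : {set V} -> {set V} -> {set V} -> bool)
    (eps eps' : RR) (P : {set {set V}}) : eps <= eps' ->
  (forall X Y Z : {set V}, (0 < #|X|)%N -> (0 < #|Y|)%N -> (0 < #|Z|)%N -> g X Y Z -> g' X Y Z) ->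
  good_partition g eps P -> good_partition g' eps' P.
Proof.
move=> ee gg' /andP[Ppart gP]; rewrite /good_partition Ppart /=.
have Pne X : X \in P -> (0 < #|X|)%N.
  move=> XP; rewrite card_gt0; apply: contraTneq XP => ->.
  by case/and3P: Ppart.
apply: le_trans (_ : (1 - eps) * (#|V| ^ 3)%N%:R <= _).
  by rewrite ler_wpM2r // lerD2l lerN2.
apply: le_trans gP _; rewrite ler_nat; apply: subset_leq_card; apply/subsetP => t.
rewrite !inE => /exists_inP[X XP /exists_inP[Y YP /exists_inP[Z ZP /andP[gXYZ tXYZ]]]].
apply/exists_inP; exists X => //; apply/exists_inP; exists Y => //.
apply/exists_inP; exists Z => //; rewrite gg' ?Pne //.
Qed.

Lemma reg_bound_of_hom (H : prop3) (eps : RR) M : 0 < eps <= 1 ->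
  hom_bound H (eps ^+ 4) M -> reg_bound H eps M.
Proof.
move=> e01 [n0 n0P]; exists n0 => V E HE nV; have [P [Phom PM]] := n0P V E HE nV.
exists P; split=> //; apply: good_partition_mono Phom.
  by case/andP: e01 => e0 e1; rewrite exprS ler_piMr ?exprn_ile1 // ltW.
by move=> X Y Z X0 Y0 Z0; exact: regular_of_homogeneous.
Qed.

Lemma ex_least (Q : nat -> Prop) M : Q M -> exists m, [/\ Q m, (m <= M)%N & forall M', Q M' -> (m <= M')%N].
Proof.
move=> QM; have exQ : exists m, `[< Q m >] by exists M; apply/asboolP.
case: (ex_minnP exQ) => m /asboolP Qm mmin.
exists m; split=> // [|M' QM']; by apply: mmin; apply/asboolP.
Qed.

Lemma powR_tower2 (a : RR) (s : nat) : s%:R <= a ->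
  (2 ^ (2 ^ s))%N%:R <= powR 2 (powR 2 a) :> RR.
Proof.
move=> sa; rewrite natrX -powR_mulrn // ler_powR ?ler1n // natrX -powR_mulrn //.
by rewrite ler_powR ?ler1n.
Qed.

Lemma homogeneous_growth (H : prop3) :
  (exists k : nat, (1 <= k)%N /\ ~ in_Trip H (kU k)) ->
    MHhom_defined H /\
    exists K : RR, 0 < K /\
    exists eps0 : RR, 0 < eps0 /\
    forall eps : RR, 0 < eps -> eps < eps0 ->
      exists m mh : nat, is_MH H eps m /\ is_MHhom H (eps ^+ 4) mh /\
        (m <= mh)%N /\
        mh%:R <= powR 2 (powR 2 (powR eps (- K))).
Proof.
move=> [k [k_gt0 noU]]; have [s0 s0P] := hom_bound_of_notin_Trip k_gt0 noU.
split.
  move=> eps e0; pose a := 66%:R / eps ^+ 2; pose s := (s0 + (Num.truncn a).+1)%N.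
  exists (2 ^ (2 ^ s))%N; apply: s0P => //; first by rewrite leq_addr.
  rewrite -ler_pdivrMr ?exprn_gt0 // -/a natrD.
  have := truncnS_gt a; have : 0 <= s0%:R :> RR by []; lra.
(* Homogeneity [eps ^ 4] needs [s] of order [eps ^ -8]; the exponent 9 leaves a factor [1 / eps], at
   least [68 + s0], for the constant 66, the rounding and the threshold [s0]. *)
exists 9%:R; split=> //.
pose eps0 : RR := (68 + s0)%N%:R^-1.
have c0 : 0 < (68 + s0)%N%:R :> RR by rewrite ltr0n.
exists eps0; split; first by rewrite invr_gt0.
move=> eps e0 ee0.
have ie : (68 + s0)%N%:R <= eps^-1 by rewrite -[leLHS]invrK lef_pV2 ?posrE ?invr_gt0 // ltW.
have e1 : eps <= 1.
  by apply: ltW (lt_le_trans ee0 _); rewrite invf_le1 // ler1n.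
set a := powR eps (- 9%:R).
have aE : a = eps ^- 9 by rewrite /a powRN powR_mulrn ?ltW.
pose s := Num.truncn a.
have a0 : 0 <= a by rewrite powR_ge0.
have sa : s%:R <= a by rewrite truncn_le.
have sa' : a < s%:R + 1 by rewrite -[X in _ + X]/(1%:R) -natrD addn1 truncnS_gt.
have e4 : 0 < eps ^+ 4 by rewrite exprn_gt0.
have ia : eps^-1 <= a.
  by rewrite aE -exprVn -[leLHS]expr1 ler_weXn2l // invf_ge1.
have s0s : (s0 <= s)%N.
  have : (68 + s0)%N%:R < s%:R + 1 :> RR by lra.
  by rewrite natr1 ltr_nat; lia.
have seps : 66%:R <= s%:R * (eps ^+ 4) ^+ 2.
  have : a * eps ^+ 8 = eps^-1.
    by rewrite aE exprS; field; rewrite gt_eqF.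
  have e8 : eps ^+ 8 <= 1 by rewrite exprn_ile1 // ltW.
  have e8' : 0 < eps ^+ 8 by rewrite exprn_gt0.
  have s0' : 68%:R <= (68 + s0)%N%:R :> RR by rewrite ler_nat leq_addr.
  rewrite -exprM -/(8%N); nra.
have hb := s0P s _ s0s e4 seps.
have [mh [hmh mhle mhmin]] := ex_least hb.
have e01 : 0 < eps <= 1 by rewrite e0.
have [m [hm mle mmin]] := ex_least (reg_bound_of_hom e01 hmh).
exists m, mh; split; first by split.
split; first by split.
split=> //; apply: le_trans (powR_tower2 sa); by rewrite ler_nat.
Qed.

(** * The energy increment *)

Lemma fib_avg_selfadj (V : finType) (T : eqType) (c : V -> T) (F G : V -> RR) :
  \sum_v G v * fib_avg c v F = \sum_v fib_avg c v G * F v.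
Proof.
rewrite /fib_avg; under eq_bigr do rewrite mulr_sumr.
under [RHS]eq_bigr do rewrite mulr_suml.
rewrite exchange_big; apply: eq_bigr => u _; apply: eq_bigr => v _ /=.
by rewrite fib_weightC; ring.
Qed.

Lemma fib_avg_saturated (V : finType) (T : eqType) (c : V -> T) (F : V -> RR) v :
  (forall u, c u = c v -> F u = F v) -> fib_avg c v F = F v.
Proof.
move=> Fc; rewrite -[RHS](fib_avg_cst c v); apply/eqP; rewrite eq_le.
by apply/andP; split; apply: le_fib_avg => u /Fc ->.
Qed.

Lemma fib_avg_class (V : finType) (T : eqType) (c : V -> T) (F : V -> RR) u v :
  c u = c v -> fib_avg c u F = fib_avg c v F.
Proof.
by move=> /eqP/eq_fib e; rewrite !fib_avgE e.
Qed.

Definition energy (V : finType) (T : eqType) (c : V -> T) (F : V -> RR) : RR :=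
  \sum_v fib_avg c v F ^+ 2.

Lemma energyE (V : finType) (T : eqType) (c : V -> T) (F : V -> RR) :
  energy c F = \sum_v fib_avg c v F * F v.
Proof.
rewrite /energy; under eq_bigr do rewrite expr2.
rewrite fib_avg_selfadj; apply: eq_bigr => v _; congr (_ * _).
by apply: fib_avg_saturated => u; exact: fib_avg_class.
Qed.

Lemma fib_avg_refine (V : finType) (T T' : eqType) (c : V -> T) (c' : V -> T') (F : V -> RR) v :
  (forall u v, c' u = c' v -> c u = c v) ->
  fib_avg c v (fun u => fib_avg c' u F) = fib_avg c v F.
Proof.
move=> cc'; transitivity (\sum_u fib_avg c' u (fib_weight c v) * F u).
  exact: fib_avg_selfadj.
apply: eq_bigr => u _; congr (_ * _); apply: fib_avg_saturated => w /cc' cw.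
by rewrite /fib_weight cw.
Qed.

(** Pythagoras for the nested orthogonal projections [fib_avg c] and [fib_avg c']. *)
Lemma energy_increment (V : finType) (T T' : eqType) (c : V -> T) (c' : V -> T') (F : V -> RR) :
  (forall u v, c' u = c' v -> c u = c v) ->
  energy c' F = energy c F + \sum_v (fib_avg c' v F - fib_avg c v F) ^+ 2.
Proof.
move=> cc'; have mix : \sum_v fib_avg c' v F * fib_avg c v F = energy c F.
  rewrite fib_avg_selfadj energyE; apply: eq_bigr => v _; congr (_ * _).
  exact: fib_avg_refine.
rewrite (eq_bigr (fun v => fib_avg c' v F ^+ 2 - 2%:R * (fib_avg c' v F * fib_avg c v F)
  + fib_avg c v F ^+ 2)) => [|v _]; last by ring.
rewrite big_split sumrB /= -mulr_sumr mix /energy; ring.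
Qed.

Lemma energy_le (V : finType) (T : eqType) (c : V -> T) (F : V -> RR) :
  (forall v, 0 <= F v <= 1) -> energy c F <= #|V|%:R.
Proof.
move=> F01; rewrite energyE -sum1_card natr_sum; apply: ler_sum => v _.
have a1 : fib_avg c v F <= 1.
  by rewrite -[leRHS](fib_avg_cst c v); apply: le_fib_avg => u _; case/andP: (F01 u).
have a0 : 0 <= fib_avg c v F.
  by rewrite -[leLHS](fib_avg_cst c v); apply: le_fib_avg => u _; case/andP: (F01 u).
by case/andP: (F01 v) => f0 f1; rewrite mulr_ile1.
Qed.

Lemma sum_sqr_ge (V : finType) (S : {set V}) (G : V -> RR) (lam : RR) :
  \sum_(v in S) G v = lam * #|S|%:R -> lam ^+ 2 * #|S|%:R <= \sum_(v in S) G v ^+ 2.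
Proof.
move=> GS; have -> : lam ^+ 2 * #|S|%:R = \sum_(v in S) (2%:R * lam * G v - lam ^+ 2).
  rewrite sumrB -mulr_sumr GS sumr_const -mulr_natr; ring.
by apply: ler_sum => v _; have := sqr_ge0 (G v - lam); rewrite sqrrB; lra.
Qed.

(** As [S] is a union of classes of [c'], averaging over these classes preserves the sum over [S].
    The deviation [lam] of the mean on [S] thus survives, and Cauchy-Schwarz bounds the squares from
    below. *)
Lemma local_increment (V : finType) (T T' : eqType) (c : V -> T) (c' : V -> T') (F : V -> RR)
    (v0 : V) (S : {set V}) (lam : RR) :
  (forall u v, c' u = c' v -> (u \in S) = (v \in S)) -> S \subset fib c v0 ->
  lam = (\sum_(v in S) F v) / #|S|%:R - fib_avg c v0 F ->
  lam ^+ 2 * #|S|%:R / #|fib c v0|%:R <=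
    fib_avg c v0 (fun v => (fib_avg c' v F - fib_avg c v F) ^+ 2).
Proof.
move=> Sc' Sc lamE; rewrite fib_avgE ler_pM2r ?invr_gt0 ?fib_card_gt0 //.
apply: le_trans (_ : \sum_(v in S) (fib_avg c' v F - fib_avg c v F) ^+ 2 <= _); last first.
  rewrite big_mkcond [leRHS]big_mkcond; apply: ler_sum => v _.
  by case: ifP => [/(subsetP Sc) -> //|_]; case: ifP => // _; exact: sqr_ge0.
apply: sum_sqr_ge.
have [->|[s sS]] := set_0Vmem S; first by rewrite big_set0 cards0 mulr0.
have S0 : #|S|%:R != 0 :> RR by rewrite pnatr_eq0 -lt0n; apply/card_gt0P; exists s.
rewrite sumrB lamE mulrBl divfK //; congr (_ - _).
  rewrite big_mkcond [RHS]big_mkcond /=.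
  transitivity (\sum_v (v \in S)%:R * fib_avg c' v F).
    by apply: eq_bigr => v _; case: ifP; rewrite ?mul1r ?mul0r.
  rewrite fib_avg_selfadj; apply: eq_bigr => v _.
  rewrite fib_avg_saturated => [|u /Sc' -> //].
  by case: ifP; rewrite ?mul1r ?mul0r.
rewrite (eq_bigr (fun=> fib_avg c v0 F)) => [|v /(subsetP Sc)]; last first.
  by rewrite fibE => /eqP cv; apply: fib_avg_class.
by rewrite sumr_const mulr_natr.
Qed.

(** Colouring triples makes the classes boxes and the class averages of [edge_ind] densities, so
    that the energy of a function of one variable suffices. *)
Definition cube (V T : Type) (chi : V -> T) (t : V * V * V) : T * T * T :=
  (chi t.1.1, chi t.1.2, chi t.2).

Lemma eq_cube (V T : Type) (chi : V -> T) t u : cube chi t = cube chi u ->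
  [/\ chi t.1.1 = chi u.1.1, chi t.1.2 = chi u.1.2 & chi t.2 = chi u.2].
Proof.
by rewrite /cube => e; split; case: e.
Qed.

Definition edge_ind (V : finType) (E : {set {set V}}) (t : V * V * V) : RR :=
  (edge E t.1.1 t.1.2 t.2)%:R.

Lemma fib_cube (V : finType) (T : eqType) (chi : V -> T) t :
  fib (cube chi) t = box (fib chi t.1.1) (fib chi t.1.2) (fib chi t.2).
Proof.
apply/setP => -[[x y] z]; by rewrite !inE /cube /= !xpair_eqE andbA.
Qed.

Lemma sum_edge_ind (V : finType) (E : {set {set V}}) (X Y Z : {set V}) :
  \sum_(t in box X Y Z) edge_ind E t = #|edges_in E X Y Z|%:R.
Proof.
rewrite -sum1_card natr_sum big_mkcond [RHS]big_mkcond; apply: eq_bigr => t _ /=.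
by rewrite mem_edges_in /edge_ind; case: (t \in _) => //=; case: edge.
Qed.

Lemma density_cube (V : finType) (T : eqType) (chi : V -> T) (E : {set {set V}}) t :
  fib_avg (cube chi) t (edge_ind E)
    = density E (fib chi t.1.1) (fib chi t.1.2) (fib chi t.2).
Proof. by rewrite fib_avgE densityE fib_cube sum_edge_ind. Qed.

Definition irregularity_witness (V : finType) (E : {set {set V}}) (eps : RR)
    (X Y Z : {set V}) (W : {set V} * {set V} * {set V}) : bool :=
  [&& W.1.1 \subset X, W.1.2 \subset Y, W.2 \subset Z,
      eps * #|X|%:R <= #|W.1.1|%:R, eps * #|Y|%:R <= #|W.1.2|%:R & eps * #|Z|%:R <= #|W.2|%:R]
  && (eps < `|density E X Y Z - density E W.1.1 W.1.2 W.2|).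

Lemma irregularP (V : finType) (E : {set {set V}}) (eps : RR) (X Y Z : {set V}) :
  ~~ eps_regular E eps X Y Z -> exists W, irregularity_witness E eps X Y Z W.
Proof.
move=> /forallPn[X' /forallPn[Y' /forallPn[Z']]]; rewrite negb_imply -ltNge => h.
by exists (X', Y', Z').
Qed.

(** Every triple of colours contributes three witness sets, that is three bits per vertex: hence
    [8 ^ (#|T| ^ 3)]. An irregular triple of vertices gains [eps ^ 2] from the deviation times
    [eps ^ 3] from the volume of the witness, and a proportion [eps] of all triples is irregular. *)
Lemma regularity_step (V T : finType) (E : {set {set V}}) (chi : V -> T) (eps : RR) :
  0 < eps -> ~~ eps_regular_partition E eps (fibres chi) ->
  exists (T' : finType) (chi' : V -> T'), #|T'| = (#|T| * 8 ^ (#|T| ^ 3))%N /\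
    energy (cube chi) (edge_ind E) + eps ^+ 6 * (#|V| ^ 3)%N%:R
      <= energy (cube chi') (edge_ind E).
Proof.
move=> e0 irr; pose F (i : T) := [set u | chi u == i].
have [W WP] : exists W : T * T * T -> {set V} * {set V} * {set V}, forall i,
    ~~ eps_regular E eps (F i.1.1) (F i.1.2) (F i.2) ->
    irregularity_witness E eps (F i.1.1) (F i.1.2) (F i.2) (W i).
  apply: (@fin_all_exists _ _ (fun i w => ~~ eps_regular E eps (F i.1.1) (F i.1.2) (F i.2) ->
    irregularity_witness E eps (F i.1.1) (F i.1.2) (F i.2) w)) => i.
  have [reg|/irregularP[w]] := boolP (eps_regular E eps (F i.1.1) (F i.1.2) (F i.2)).
    by exists (set0, set0, set0).
  by exists w.
pose T' := (T * {ffun T * T * T -> bool * bool * bool})%type.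
pose chi' (v : V) : T' :=
  (chi v, [ffun i => (v \in (W i).1.1, v \in (W i).1.2, v \in (W i).2)]).
exists T', chi'; split.
  by rewrite card_prod card_ffun !card_prod !card_bool !expnS muln1 mulnA.
have chiP u v : chi' u = chi' v -> chi u = chi v /\
    forall i, [/\ (u \in (W i).1.1) = (v \in (W i).1.1),
      (u \in (W i).1.2) = (v \in (W i).1.2) & (u \in (W i).2) = (v \in (W i).2)].
  move=> [-> /ffunP h]; split=> // i; have := h i; rewrite !ffunE => -[-> -> ->].
  by split.
rewrite (@energy_increment _ _ _ (cube chi) (cube chi')); last first.
  by move=> u v /eq_cube[/chiP[e1 _] /chiP[e2 _] /chiP[e3 _]]; rewrite /cube e1 e2 e3.
rewrite lerD2l -(sum_fib_avg (cube chi)).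
set B := [set t : V * V * V | ~~ eps_regular E eps (fib chi t.1.1) (fib chi t.1.2) (fib chi t.2)].
have Bbig : eps * (#|V| ^ 3)%N%:R <= #|B|%:R.
  by apply: ltW; rewrite ltNge; apply: contra irr => /good_fibres.
apply: le_trans (_ : \sum_(t in B) eps ^+ 5 <= _).
  by rewrite sumr_const -[leRHS]mulr_natr exprSr -mulrA ler_pM2l ?exprn_gt0.
rewrite big_mkcond; apply: ler_sum => t _; case: ifP => [tB|_]; last first.
  by rewrite -(fib_avg_cst (cube chi) t 0); apply: le_fib_avg => u _; exact: sqr_ge0.
pose i := cube chi t; move: tB; rewrite inE => /(WP i)/andP[/and5P[sX sY sZ hX /andP[hY hZ]] dev].
pose S := box (W i).1.1 (W i).1.2 (W i).2.
have fibE : fib (cube chi) t = box (F i.1.1) (F i.1.2) (F i.2) by rewrite fib_cube.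
have sS : S \subset fib (cube chi) t by rewrite fibE subset_box.
have satS u v : cube chi' u = cube chi' v -> (u \in S) = (v \in S).
  move=> /eq_cube[/chiP[_ /(_ i)[xx _ _]] /chiP[_ /(_ i)[_ yy _]] /chiP[_ /(_ i)[_ _ zz]]].
  by rewrite !inE xx yy zz.
have cS : eps ^+ 3 * #|fib (cube chi) t|%:R <= #|S|%:R.
  by rewrite fibE card_box_ge // ltW.
apply: le_trans (local_increment satS sS erefl).
rewrite ler_pdivlMr ?fib_card_gt0 // -[5%N]/(2 + 3)%N exprD -mulrA.
rewrite ler_pM ?exprn_ge0 ?mulr_ge0 ?exprn_ge0 ?(ltW e0) //.
rewrite -[leRHS]real_normK ?num_real // lerXn2r ?nnegrE ?(ltW e0) //.
by rewrite ltW // distrC density_cube sum_edge_ind -densityE.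
Qed.

(** One refinement costs two exponentials; [Tw 4 = 16] is large enough for them to absorb the cube
    and the factor [p]. *)
Lemma Tw_step (i p : nat) : (4 <= i)%N -> (p <= Tw i)%N -> (p * 8 ^ (p ^ 3) <= Tw i.+2)%N.
Proof.
case: i => [|[|[|[|i]]]] // _; set P := Tw _ => pP.
have P16 : (16 <= P)%N.
  rewrite /P; elim: i {P pP} => // i IH; apply: leq_trans IH _.
  by rewrite [leqRHS]/= ltnW // ltn_expl.
have P3 : (P + 3 * P ^ 3 <= 2 ^ P)%N.
  have : (4 * P ^ 3 <= 2 ^ P)%N.
    rewrite -(subnK P16); elim: (P - 16)%N => // q IH.
    rewrite addSn [leqRHS]expnS; apply: leq_trans (leq_mul (leqnn 2) IH).
    move: (q + 16)%N (leq_addl q 16) => r; rewrite !expnS !expn0; nia.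
  by rewrite !expnS; nia.
apply: leq_trans (_ : P * 8 ^ (P ^ 3) <= _)%N.
  by rewrite leq_mul // leq_exp2l // leq_expn_mono.
have -> : Tw i.+4.+2 = (2 ^ (2 ^ P))%N by [].
apply: leq_trans (_ : 2 ^ P * 2 ^ (3 * P ^ 3) <= _)%N.
  by rewrite leq_mul // ?[(2 ^ (3 * _))%N]expnM // ltnW // ltn_expl.
by rewrite -expnD leq_exp2l.
Qed.

Lemma regularity_iterate (V : finType) (E : {set {set V}}) (eps : RR) (j : nat) : 0 < eps ->
  (exists P, eps_regular_partition E eps P /\ (#|P| <= Tw (4 + 2 * j))%N) \/
  (exists (T : finType) (chi : V -> T), (#|T| <= Tw (4 + 2 * j))%N /\
    j%:R * (eps ^+ 6 * (#|V| ^ 3)%N%:R) <= energy (cube chi) (edge_ind E)).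
Proof.
move=> e0; elim: j => [|j [[P [Preg Pj]]|[T [chi [Tj ener]]]]].
- right; exists unit, (fun=> tt); split; first by rewrite card_unit.
  by rewrite mul0r sumr_ge0 // => t _; rewrite sqr_ge0.
- left; exists P; split=> //; apply: leq_trans Pj _.
  rewrite mulnS addnCA; apply: ltnW; apply: leq_trans (ltn_expl _ (isT : 1 < 2)%N) _.
  by rewrite ltnW // ltn_expl.
have [reg|/(regularity_step e0)[T' [chi' [T'E ener']]]] :=
  boolP (eps_regular_partition E eps (fibres chi)).
  left; exists (fibres chi); split=> //; apply: leq_trans (card_fibres chi) _.
  apply: leq_trans Tj _.
  rewrite mulnS addnCA; apply: ltnW; apply: leq_trans (ltn_expl _ (isT : 1 < 2)%N) _.
  by rewrite ltnW // ltn_expl.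
right; exists T', chi'; split.
  by rewrite T'E mulnS addnCA; apply: Tw_step.
by apply: le_trans ener'; rewrite -natr1 mulrDl mul1r lerD2r.
Qed.

Lemma reg_bound_Tw (H : prop3) (eps : RR) (j : nat) : 0 < eps ->
  1 < j%:R * eps ^+ 6 -> reg_bound H eps (Tw (4 + 2 * j)).
Proof.
move=> e0 je; exists 1%N => V E _ V0.
have [//|[T [chi [_ ener]]]] := regularity_iterate E j e0.
have : energy (cube chi) (edge_ind E) <= (#|V| ^ 3)%N%:R.
  apply: le_trans (energy_le _ _) _ => [t|]; last first.
    by rewrite !card_prod !expnS muln1 mulnA.
  by rewrite /edge_ind; case: edge; rewrite ?lexx ?ler01.
have n0 : 0 < (#|V| ^ 3)%N%:R :> RR by rewrite ltr0n expn_gt0 V0.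
by rewrite leNgt; case/negP; apply: lt_le_trans ener; rewrite mulrA -ltr_pdivrMr // divff ?gt_eqF.
Qed.

(** * Forcing refinements along a chain of bipartite graphs *)

Local Open Scope nat_scope.

Lemma class_count (X T : finType) (c : X -> T) (R S : {set X}) (m l : nat) :
  (forall v, m * #|R :&: fib c v| <= l * #|S :&: fib c v|) -> m * #|R| <= l * #|S|.
Proof.
move=> h; have split (A : {set X}) : #|A| = \sum_t #|A :&: [set u | c u == t]|.
  rewrite -sum1_card (partition_big c predT) //=; apply: eq_bigr => t _.
  by rewrite -sum1_card; apply: eq_bigl => v; rewrite !inE.
rewrite (split R) (split S) !big_distrr /=; apply: leq_sum => t _.
have [/existsP[v /eqP <-]|] := boolP [exists v, c v == t]; first exact: h.
rewrite negb_exists => /forallP ne.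
suff -> : [set u | c u == t] = set0 by rewrite !setI0 cards0 !muln0.
by apply/setP => u; rewrite !inE (negbTE (ne u)).
Qed.

Section Impurity.
Variables (X T : finType) (c : X -> T) (k : nat) (psi : X -> 'I_k).

Definition impurity (v : X) : nat :=
  #|[set p : X * X | [&& p.1 \in fib c v, p.2 \in fib c v & psi p.1 != psi p.2]]|.

Definition impure (v : X) : bool := #|fib c v| ^ 2 <= 128 * impurity v.

Definition minority (v : X) : bool :=
  #|fib c v| < 2 * #|[set w in fib c v | psi w != psi v]|.

Lemma card_fib_gt0 v : 0 < #|fib c v|.
Proof. by apply/card_gt0P; exists v; exact: mem_fib. Qed.

Lemma fib_class u v : u \in fib c v -> fib c u = fib c v.
Proof. by rewrite fibE eq_sym => /eq_fib. Qed.

Lemma impure_class u v : u \in fib c v -> impure u = impure v.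
Proof. by move=> /fib_class e; rewrite /impure /impurity e. Qed.

Lemma impurityE v : impurity v = \sum_(u in fib c v) #|[set w in fib c v | psi w != psi u]|.
Proof.
rewrite -card_pairs; apply: eq_card => p; rewrite !inE.
by rewrite [psi _ == psi p.1]eq_sym.
Qed.

(** A minority vertex disagrees with more than half of its class, while in a pure class fewer than
    [1 / 128] of the pairs disagree. *)
Lemma card_minority : 64 * #|[set v | minority v && ~~ impure v]| <= #|X|.
Proof.
set R := [set v | _]; rewrite -[#|X|]cardsT -[leqRHS]mul1n.
apply: (@class_count _ _ c) => v; rewrite mul1n setTI.
have [imp|pure] := boolP (impure v).
  suff -> : R :&: fib c v = set0 by rewrite cards0 muln0.
  apply/setP => u; rewrite in_setI in_set0; apply/negP => /andP[+ uv].
  by rewrite inE (impure_class uv) imp andbF.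
rewrite -(leq_pmul2r (card_fib_gt0 v)); move: pure; rewrite /impure -ltnNge impurityE => lt.
rewrite mulnn; apply: leq_trans (ltnW lt).
apply: leq_trans (_ : 64 * \sum_(u in R :&: fib c v) #|fib c v| <= _).
  by rewrite sum_nat_const mulnA.
apply: leq_trans (_ : 64 * \sum_(u in R :&: fib c v) 2 * #|[set w in fib c v | psi w != psi u]| <= _).
  rewrite leq_mul //; apply: leq_sum => u; rewrite in_setI inE => /andP[/andP[mi _] uv].
  by move: mi; rewrite /minority (fib_class uv) => /ltnW.
rewrite -big_distrr mulnA leq_mul // [leqRHS](big_setID R) /= setIC; exact: leq_addr.
Qed.

Variables (p : nat) (code : 'I_k -> {set 'I_p}).
Hypothesis code_dist : forall u v, u != v -> p <= 8 * #|[set i | (i \in code u) != (i \in code v)]|.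

Definition split_at (v : X) (i : 'I_p) : bool :=
  (#|fib c v| <= 4096 * #|[set w in fib c v | i \in code (psi w)]|) &&
  (#|fib c v| <= 4096 * #|[set w in fib c v | i \notin code (psi w)]|).

(* Every coordinate separates at most [impurity v] pairs, while the average
   coordinate separates at least an eighth of that many. *)
Lemma impure_split (v : X) : impure v -> p <= 16 * #|[set i | split_at v i]|.
Proof.
move=> imp; set mu := impurity v.
have mu_gt0 : 0 < mu.
  rewrite lt0n; apply/eqP => mu0; move: imp; rewrite /impure -/mu mu0 muln0.
  by rewrite leqn0 expn_eq0 /= -leqn0 leqNgt card_fib_gt0.
pose M := [set q : X * X | [&& q.1 \in fib c v, q.2 \in fib c v & psi q.1 != psi q.2]].
pose d i := #|[set q in M | (i \in code (psi q.1)) != (i \in code (psi q.2))]|.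
have d_le i : d i <= mu by apply: subset_leq_card; apply/subsetP => q; rewrite inE => /andP[].
have d_sum : p * mu <= 8 * \sum_i d i.
  rewrite -(double_count M (fun q i => (i \in code (psi q.1)) != (i \in code (psi q.2)))).
  rewrite mulnC -sum_nat_const big_distrr /=; apply: leq_sum => q.
  by rewrite inE => /and3P[_ _]; exact: code_dist.
(* The [d i] average at least [mu / 8] and none exceeds [mu], so at least [p / 16] of them reach
   [mu / 16]. For these [#|A1| * #|A0|] is at least [mu / 32], and with the 128 of [impure] this
   gives 4096. *)
pose I := [set i | mu <= 16 * d i].
have cI : p <= 16 * #|I|.
  rewrite -(leq_pmul2r mu_gt0).
  have : \sum_i d i = \sum_(i in I) d i + \sum_(i in ~: I) d i.
    by rewrite (bigID (mem I)) /=; congr (_ + _); apply: eq_bigl => i; rewrite !inE.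
  have : \sum_(i in I) d i <= #|I| * mu by rewrite -sum_nat_const; apply: leq_sum.
  have : 16 * \sum_(i in ~: I) d i <= p * mu.
    apply: leq_trans (_ : #|~: I| * mu <= _).
      rewrite -sum_nat_const big_distrr; apply: leq_sum => i /=.
      by rewrite !inE -ltnNge => /ltnW.
    by rewrite leq_mul // -[leqRHS]card_ord max_card.
  move: d_sum; lia.
apply: leq_trans cI _; rewrite leq_mul //; apply: subset_leq_card; apply/subsetP => i.
rewrite !inE => di; rewrite /split_at.
set A1 := [set w in fib c v | i \in code (psi w)].
set A0 := [set w in fib c v | i \notin code (psi w)].
have fA : #|fib c v| = #|A1| + #|A0|.
  rewrite -(cardsID [set w | i \in code (psi w)]); congr (_ + _); apply: eq_card => w.
    by rewrite !inE.
  by rewrite !inE andbC.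
have dA : d i <= 2 * (#|A1| * #|A0|).
  have -> : 2 * (#|A1| * #|A0|) = #|setX A1 A0| + #|setX A0 A1| by rewrite !cardsX; lia.
  apply: leq_trans (leq_card_setU _ _); apply: subset_leq_card; apply/subsetP => -[u w].
  rewrite !inE /= => /andP[/and3P[-> -> _]].
  by case: (i \in code (psi u)); case: (i \in code (psi w)).
have := imp; rewrite /impure -/mu => imp'.
have f_gt0 := card_fib_gt0 v.
have key : #|fib c v| * #|fib c v| <= 4096 * (#|A1| * #|A0|).
  by rewrite mulnn; apply: leq_trans imp' _; lia.
apply/andP; split; rewrite -(leq_pmul2r f_gt0); apply: leq_trans key _.
  by rewrite mulnA leq_mul // fA leq_addl.
by rewrite mulnA mulnAC leq_mul // fA leq_addr.
Qed.
End Impurity.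

Lemma card_small_parts (V X : finType) (P : {set {set V}}) (al : X -> V) (t : nat) :
  injective al -> partition P [set: V] ->
  t * #|[set x | t * #|fib (pblock P \o al) x| < #|pblock P (al x)|]| <= #|V|.
Proof.
move=> ali /and3P[/eqP cov triv _].
set R := [set x | _]; rewrite -(card_imset _ ali) -[#|V|]cardsT -[leqRHS]mul1n.
apply: (@class_count _ _ (pblock P)) => v; rewrite mul1n setTI.
have Pv : fib (pblock P) v = pblock P v.
  by apply/setP => u; rewrite inE eq_sym eq_pblock ?cov ?inE.
have [->|[w]] := set_0Vmem (al @: R :&: fib (pblock P) v); first by rewrite cards0 muln0.
rewrite in_setI => /andP[/imsetP[x xR ->]]; rewrite fibE => /eqP vx.
rewrite Pv vx; move: xR; rewrite inE => /ltnW; apply: leq_trans; rewrite leq_mul //.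
rewrite -(card_imset _ ali); apply: subset_leq_card; apply/subsetP => w'.
rewrite in_setI => /andP[/imsetP[x' _ ->]] => /(same_pblock triv) e.
by apply: imset_f; rewrite fibE /= e.
Qed.

Local Open Scope ring_scope.

Lemma not_regular_gap (V : finType) (E : {set {set V}}) (eps : RR) (X Y Z X' Y1 Y0 Z' : {set V}) :
  eps < 2%:R^-1 -> X' \subset X -> Y1 \subset Y -> Y0 \subset Y -> Z' \subset Z ->
  eps * #|X|%:R <= #|X'|%:R -> eps * #|Y|%:R <= #|Y1|%:R -> eps * #|Y|%:R <= #|Y0|%:R ->
  eps * #|Z|%:R <= #|Z'|%:R ->
  (0 < #|X'|)%N -> (0 < #|Y1|)%N -> (0 < #|Z'|)%N ->
  (forall x y z, x \in X' -> y \in Y1 -> z \in Z' -> edge E x y z) ->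
  (forall x y z, x \in X' -> y \in Y0 -> z \in Z' -> ~~ edge E x y z) ->
  ~~ eps_regular E eps X Y Z.
Proof.
move=> e2 sX sY1 sY0 sZ hX hY1 hY0 hZ nX nY nZ full empty; apply/negP => reg.
have d1 : density E X' Y1 Z' = 1.
  rewrite densityE (_ : edges_in E X' Y1 Z' = box X' Y1 Z').
    by rewrite divff // pnatr_eq0 card_box -lt0n !muln_gt0 nX nY.
  apply/setP => t; rewrite mem_edges_in andb_idr // inE => /and3P[]; exact: full.
have d0 : density E X' Y0 Z' = 0.
  rewrite densityE (_ : edges_in E X' Y0 Z' = set0) ?cards0 ?mul0r //.
  apply/setP => t; rewrite mem_edges_in in_set0; apply/negP => /andP[].
  by rewrite inE => /and3P[tX tY tZ]; apply/negP; exact: empty.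
have r1 : `|density E X Y Z - 1| <= eps.
  have /forallP/(_ X')/forallP/(_ Y1)/forallP/(_ Z')/implyP := reg.
  by rewrite d1; apply; rewrite sX sY1 sZ hX hY1 hZ.
have r0 : `|density E X Y Z - 0| <= eps.
  have /forallP/(_ X')/forallP/(_ Y0)/forallP/(_ Z')/implyP := reg.
  by rewrite d0; apply; rewrite sX sY0 sZ hX hY0 hZ.
move: r1 r0; rewrite !ler_norml => /andP[? ?] /andP[? ?]; lra.
Qed.

Lemma card_preim_balanced (X : finType) (p : nat) (phi : X -> 'I_p) (I : {set 'I_p}) :
  (forall i, p * #|[set x | phi x == i]| = #|X|)%N ->
  (p * #|[set x | phi x \in I]| = #|I| * #|X|)%N.
Proof.
move=> bal; have -> : #|[set x | phi x \in I]| = (\sum_(i in I) #|[set x | phi x == i]|)%N.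
  rewrite double_count -sum1dep_card big_mkcond; apply: eq_bigr => x _.
  have [xI|xI] := boolP (phi x \in I).
    rewrite (_ : [set a in I | _] = [set phi x]) ?cards1 //.
    by apply/setP => i; rewrite !inE eq_sym andb_idl // => /eqP ->.
  apply/esym/eqP; rewrite cards_eq0 -subset0; apply/subsetP => i; rewrite !inE.
  by case/andP => iI /eqP e; rewrite e iI in xI.
by rewrite big_distrr -sum_nat_const; apply: eq_bigr => i _; rewrite /= bal.
Qed.

Section Step.
Variables (V : finType) (E : {set {set V}}) (eps : RR) (P : {set {set V}}) (r : nat).
Hypotheses (eps_gt0 : 0 < eps) (eps_r : eps * (2%:R ^+ 20 * r%:R ^+ 3) <= 1).
Hypothesis Preg : eps_regular_partition E eps P.

Variables (X Y Z : finType) (al : X -> V) (be : Y -> V) (ga : Z -> V).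
Hypotheses (ali : injective al) (bei : injective be) (gai : injective ga).
Hypotheses (Xbig : (#|V| <= r * #|X|)%N) (Ybig : (#|V| <= r * #|Y|)%N)
  (Zbig : (#|V| <= r * #|Z|)%N) (V_gt0 : (0 < #|V|)%N).

Variables (p k : nat) (phi : X -> 'I_p) (psi : Y -> 'I_k) (code : 'I_k -> {set 'I_p}).
Hypothesis code_dist :
  forall u v, u != v -> (p <= 8 * #|[set i | (i \in code u) != (i \in code v)]|)%N.
Hypothesis phi_bal : forall i, (p * #|[set x | phi x == i]| = #|X|)%N.
Hypothesis edgeE : forall x y z, edge E (al x) (be y) (ga z) = (phi x \in code (psi y)).

Let cX := pblock P \o al.
Let cY := pblock P \o be.
Let cZ := pblock P \o ga.

(** The block meets the part too thinly for its subsets to be tested by regularity. By [card_small],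
    at most [1 / 256] of a block is lost in this way. *)
Definition small_part (W : finType) (f : W -> V) (w : W) : bool :=
  (256 * r * #|fib (pblock P \o f) w| < #|pblock P (f w)|)%N.

Let r_gt0 : (0 < r)%N.
Proof. by case: r Xbig V_gt0 => // h1 h2; move: (leq_trans h2 h1). Qed.

Let P_part : partition P [set: V].
Proof. by case/andP: Preg. Qed.

Lemma card_small (W : finType) (f : W -> V) : injective f -> (#|V| <= r * #|W|)%N ->
  (256 * #|[set w | small_part f w]| <= #|W|)%N.
Proof.
move=> fi Wbig; have := card_small_parts (256 * r) fi P_part.
rewrite -/(small_part f) => h; rewrite -(leq_pmul2l r_gt0); apply: leq_trans _ Wbig.
by apply: leq_trans _ h; rewrite mulnA [(r * _)%N]mulnC.
Qed.

Lemma image_in_part (W : finType) (f : W -> V) (w : W) (Q : pred W) :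
  f @: [set u in fib (pblock P \o f) w | Q u] \subset pblock P (f w).
Proof.
apply/subsetP => _ /imsetP[u + ->]; rewrite inE fibE /= => /andP[/eqP -> _].
by rewrite mem_pblock; case/and3P: P_part => /eqP -> _ _; rewrite inE.
Qed.

(** The [2 ^ 20] in the hypothesis on [eps] covers the 256 of [small_part] times the 4096 of
    [split_at]. *)
Lemma part_le (W : finType) (f : W -> V) (w : W) (Q : pred W) (m : nat) : injective f ->
  ~~ small_part f w -> (m <= 4096)%N ->
  (#|fib (pblock P \o f) w| <= m * #|[set u in fib (pblock P \o f) w | Q u]|)%N ->
  eps * #|pblock P (f w)|%:R <= #|f @: [set u in fib (pblock P \o f) w | Q u]|%:R
  /\ (0 < #|f @: [set u in fib (pblock P \o f) w | Q u]|)%N.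
Proof.
move=> fi; rewrite /small_part -leqNgt => nsm m4 fm; rewrite card_imset //.
set q := #|[set u in _ | Q u]| in fm *.
have f_gt0 : (0 < #|fib (pblock P \o f) w|)%N by apply/card_gt0P; exists w; exact: mem_fib.
split; last by case: q fm => //; rewrite muln0 leqNgt f_gt0.
have le : #|pblock P (f w)|%:R <= 2%:R ^+ 8 * r%:R * (2%:R ^+ 12 * q%:R) :> RR.
  apply: le_trans (_ : (256 * r * (m * q))%N%:R <= _).
    by rewrite ler_nat; apply: leq_trans nsm _; rewrite leq_mul.
  have c8 : 256%N%:R = 2%:R ^+ 8 :> RR by rewrite -natrX.
  rewrite !natrM c8 ler_wpM2l //; first by rewrite mulr_ge0 ?exprn_ge0.
  by rewrite ler_wpM2r // -natrX ler_nat.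
have r1 : 1 <= r%:R :> RR by rewrite ler1n.
have r3 : r%:R <= r%:R ^+ 3 :> RR by rewrite -[leLHS]expr1 ler_weXn2l.
have := ler_wpM2r (ler0n RR q) eps_r; have := ler_wpM2l (ltW eps_gt0) le.
rewrite (exprD _ 8 12); have := exprn_gt0 8 (ltr0n RR 2); have := exprn_gt0 12 (ltr0n RR 2).
move: (2%:R ^+ 8) (2%:R ^+ 12) => a b a0 b0 h1 h2.
have abq : 0 <= a * b * q%:R * eps by rewrite !mulr_ge0 // ltW.
have := ler_wpM2l abq r3; lra.
Qed.

(** These conditions produce two testable sub-boxes: the vertices sharing the colour of [x] in its
    class, against the two pieces into which the coordinate [phi x] cuts the class of [y]. One
    sub-box is full, the other empty. *)
Definition split_triple (t : X * Y * Z) : bool :=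
  [&& impure cY psi t.1.2, ~~ small_part be t.1.2,
      split_at cY psi code t.1.2 (phi t.1.1), ~~ minority cX phi t.1.1,
      ~~ small_part al t.1.1 & ~~ small_part ga t.2].

Lemma split_triple_irregular t : split_triple t ->
  ~~ eps_regular E eps (pblock P (al t.1.1)) (pblock P (be t.1.2)) (pblock P (ga t.2)).
Proof.
case: t => [[x y] z] /and5P[/= _ nsy /andP[sp1 sp0] nmx /andP[nsx nsz]].
have fX : (#|fib cX x| <= 2 * #|[set u in fib cX x | phi u == phi x]|)%N.
  have fE : #|fib cX x| = (#|[set u in fib cX x | phi u == phi x]|
      + #|[set u in fib cX x | phi u != phi x]|)%N.
    rewrite -(cardsID [set u | phi u == phi x]); congr (_ + _)%N; apply: eq_card => u.
      by rewrite !inE.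
    by rewrite !inE andbC.
  move: nmx; rewrite /minority -leqNgt fE mul2n -addnn leq_add2r => h.
  by rewrite mul2n -addnn leq_add2l.
have fZ : (#|fib cZ z| <= 1 * #|[set u in fib cZ z | true]|)%N.
  by rewrite mul1n; apply: subset_leq_card; apply/subsetP => u; rewrite [in X in _ -> X]inE => ->.
have [hX nX] := part_le (m := 2) ali nsx isT fX.
have [hY1 nY1] := part_le bei nsy (leqnn _) sp1.
have [hY0 nY0] := part_le bei nsy (leqnn _) sp0.
have [hZ nZ] := part_le (m := 1) gai nsz isT fZ.
apply: not_regular_gap hX hY1 hY0 hZ nX nY1 nZ _ _; rewrite ?image_in_part //.
- have r3 : 1 <= r%:R ^+ 3 :> RR by rewrite exprn_ege1 // ler1n.
  have : 4%:R <= 2%:R ^+ 20 * r%:R ^+ 3 :> RR by rewrite (exprD _ 2 18) -[4%:R]mulr1; have := exprn_ege1 18 (ler1n RR 2); rewrite expr2; nra.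
  move/(ler_wpM2l (ltW eps_gt0)); move: eps_r; lra.
- move=> _ _ _ /imsetP[x' + ->] /imsetP[y' + ->] /imsetP[z' _ ->].
  by rewrite !inE edgeE => /andP[_ /eqP ->] /andP[_ ->].
move=> _ _ _ /imsetP[x' + ->] /imsetP[y' + ->] /imsetP[z' _ ->].
by rewrite !inE edgeE => /andP[_ /eqP ->] /andP[_ ->].
Qed.

Lemma card_split_triple : #|[set t | split_triple t]|%:R <= eps * (#|V| ^ 3)%N%:R.
Proof.
case/andP: Preg => /and3P[/eqP cov triv _] Gbig; set G := [set t | _] in Gbig.
pose F (t : X * Y * Z) := (al t.1.1, be t.1.2, ga t.2).
(* The triples are ordered, so [F] is injective even where the images of [al], [be] and [ga]
   overlap. *)
have Fi : injective F by move=> [[x y] z] [[x' y'] z'] [/ali -> /bei -> /gai ->].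
have sub : F @: [set t | split_triple t] \subset ~: G.
  apply/subsetP => _ /imsetP[t + ->]; rewrite inE => /split_triple_irregular irr.
  rewrite !inE; apply: contra irr => /exists_inP[A AP /exists_inP[B BP /exists_inP[C CP]]].
  case/and4P => reg tA tB tC.
  by rewrite (def_pblock triv AP tA) (def_pblock triv BP tB) (def_pblock triv CP tC).
have := subset_leq_card sub; rewrite card_imset // -(ler_nat RR) => le.
apply: le_trans le _; have := cardsC G; rewrite !card_prod => /(congr1 (fun m => m%:R : RR)).
rewrite natrD (_ : (_ * _ * _)%N = (#|V| ^ 3)%N); last by rewrite !expnS muln1 mulnA.
move: Gbig; lra.
Qed.

(** Otherwise [1/128 - 1/256] of [Y] is impure outside small parts. Each such [y] splits at [1/16]
    of [X]; removing the minority ([1/64]), the impure ([1/128]) and the small parts ([1/256])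
    leaves [1/32], and half of [Z] is available. So [2 ^ -14 * r ^ -3] of all triples would be
    irregular, more than [eps] allows. Hypothesis and conclusion share the constant 128, so the step
    can be iterated indefinitely. *)
Lemma impure_step : (128 * #|[set x | impure cX phi x]| <= #|X|)%N ->
  (128 * #|[set y | impure cY psi y]| <= #|Y|)%N.
Proof.
move=> hX; rewrite leqNgt; apply/negP => hY.
pose Y1 := [set y | impure cY psi y && ~~ small_part be y].
pose Z1 := [set z | ~~ small_part ga z].
pose X1 y := [set x | [&& split_at cY psi code y (phi x), ~~ minority cX phi x & ~~ small_part al x]].
have cZ1 : (#|Z| <= 2 * #|Z1|)%N.
  have := card_small gai Zbig; have := cardsC [set z | small_part ga z].
  by rewrite (_ : ~: _ = Z1); [lia | apply/setP => z; rewrite !inE].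
have cY1 : (#|Y| <= 256 * #|Y1|)%N.
  have : (#|[set y | impure cY psi y]| <= #|Y1| + #|[set y | small_part be y]|)%N.
    apply: leq_trans (leq_card_setU _ _); apply: subset_leq_card; apply/subsetP => y.
    by rewrite !inE => ->; case: small_part.
  by have := card_small bei Ybig; lia.
have cX1 y : y \in Y1 -> (#|X| <= 32 * #|X1 y|)%N.
  rewrite inE => /andP[iy _].
  have sp := impure_split code_dist iy.
  have := card_preim_balanced [set i | split_at cY psi code y i] phi_bal.
  set S := [set x | _] => bal.
  have cS : (#|X| <= 16 * #|S|)%N.
    have [p0|p_gt0] := posnP p.
      suff -> : #|X| = 0%N by []. 
      apply: eq_card0 => x; have := ltn_ord (phi x); by rewrite {2}p0.
    rewrite -(leq_pmul2l p_gt0) mulnCA bal mulnA leq_mul //.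
  have : (#|S| <= #|X1 y| + (#|[set x | minority cX phi x && ~~ impure cX phi x]|
     + #|[set x | impure cX phi x]| + #|[set x | small_part al x]|))%N.
    apply: leq_trans (_ : #|X1 y :|: ([set x | minority cX phi x && ~~ impure cX phi x]
     :|: [set x | impure cX phi x] :|: [set x | small_part al x])| <= _)%N; last first.
      apply: leq_trans (leq_card_setU _ _) _; rewrite leq_add2l.
      by apply: leq_trans (leq_card_setU _ _) _; rewrite leq_add2r leq_card_setU.
    apply: subset_leq_card; apply/subsetP => x; rewrite !inE => ->.
    by case: minority; case: impure; case: small_part.
  have := card_small ali Xbig; have := card_minority cX phi; lia.
have cT : (#|Y1| * (#|X| * #|Z|) <= 64 * #|[set t | split_triple t]|)%N.
  pose A := [set q : Y * X | (q.1 \in Y1) && (q.2 \in X1 q.1)].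
  pose F (q : (Y * X) * Z) : X * Y * Z := (q.1.2, q.1.1, q.2).
  have Fi : injective F by move=> [[? ?] ?] [[? ?] ?] [-> -> ->].
  have sub : F @: setX A Z1 \subset [set t | split_triple t].
    apply/subsetP => _ /imsetP[[[y x] z] + ->].
    by rewrite !inE /= => /andP[/andP[/andP[h1 h2] /and3P[h3 h4 h5]] h6]; rewrite /split_triple h1 h2 h3 h4 h5 h6.
  have := subset_leq_card sub; rewrite card_imset // cardsX card_pairs => le.
  apply: leq_trans (leq_mul (leqnn 64) le); rewrite -[64%N]/(32 * 2)%N mulnACA mulnA leq_mul //.
  by rewrite big_distrr -sum_nat_const; apply: leq_sum.
have big : (#|V| ^ 3 <= 256 * 64 * (r ^ 3 * #|[set t | split_triple t]|))%N.
  apply: leq_trans (_ : (r * #|X|) * (r * #|Y|) * (r * #|Z|) <= _)%N.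
    by rewrite !expnS muln1 mulnA leq_mul // leq_mul.
  have h1 : (#|Y| * (#|X| * #|Z|) <= 256 * (64 * #|[set t | split_triple t]|))%N.
    by apply: leq_trans (leq_mul cY1 (leqnn _)) _; rewrite -mulnA leq_mul.
  have -> : ((r * #|X|) * (r * #|Y|) * (r * #|Z|) = r ^ 3 * (#|Y| * (#|X| * #|Z|)))%N.
    by rewrite !expnS expn0; lia.
  by apply: leq_trans (leq_mul (leqnn _) h1) _; rewrite mulnCA -mulnA leq_mul // mulnCA.
set s : RR := #|[set t | split_triple t]|%:R; set n : RR := (#|V| ^ 3)%N%:R.
have h1 : n <= 256%:R * 64%:R * (r%:R ^+ 3 * s).
  by rewrite -natrX -!natrM ler_nat.
have h2 : s <= eps * n := card_split_triple.
have n_gt0 : 0 < n by rewrite ltr0n expn_gt0 V_gt0.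
have r_gt0' : 0 < r%:R ^+ 3 :> RR by rewrite exprn_gt0 // ltr0n.
have h3 := ler_wpM2l (ltW r_gt0') h2.
have h4 : eps * (2%:R ^+ 20 * r%:R ^+ 3) * n <= 1 * n by rewrite ler_pM2r.
have c20 : 2%:R ^+ 20 = 64%:R * 256%:R * 64%:R :> RR.
  by rewrite (exprD _ 14 6) (exprD _ 6 8) -!natrX.
move: h1 h3 h4; rewrite c20; lra.
Qed.
End Step.

Local Open Scope nat_scope.

(** * Recovering arbitrary bipartite graphs from Trip(H) *)

Definition side (V : Type) (p : (V + V) + V) : nat :=
  match p with inl (inl _) => 0 | inl (inr _) => 1 | inr _ => 2 end.

Definition proj (V : Type) (p : (V + V) + V) : V :=
  match p with inl (inl v) => v | inl (inr v) => v | inr v => v end.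

Lemma side_proj_inj (V : Type) (p q : (V + V) + V) : side p = side q -> proj p = proj q -> p = q.
Proof. by case: p q => [[v|v]|v] [[w|w]|w] //= _ ->. Qed.

Lemma side_lt3 (V : Type) (p : (V + V) + V) : side p < 3.
Proof. by case: p => [[v|v]|v]. Qed.

Lemma mem_trip_graph (V : finType) (E : {set {set V}}) (p q r : (V + V) + V) :
  ([set p; q; r] \in trip_graph E) =
  [&& side p != side q, side p != side r, side q != side r & edge E (proj p) (proj q) (proj r)].
Proof.
apply/idP/idP.
  rewrite inE => /existsP[a /existsP[b /existsP[c /andP[abc /eqP e]]]].
  have {abc} abc : edge E a b c by [].
  have mem u : u \in [set inl (inl a); inl (inr b); inr c] -> [|| u == p, u == q | u == r].
    by rewrite -e !inE orbA.
  have /or3P xa : [|| inl (inl a) == p, inl (inl a) == q | inl (inl a) == r].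
    by apply: mem; rewrite !inE eqxx.
  have /or3P yb : [|| inl (inr b) == p, inl (inr b) == q | inl (inr b) == r].
    by apply: mem; rewrite !inE eqxx orbT.
  have /or3P zc : [|| inr c == p, inr c == q | inr c == r].
    by apply: mem; rewrite !inE eqxx !orbT.
  clear e mem.
  by case: xa => /eqP xa; case: yb => /eqP yb; case: zc => /eqP zc; try congruence;
    rewrite -xa -yb -zc /=;
    first [exact: abc | by rewrite edgeC12 | by rewrite edgeC23 | by rewrite edgeC12 edgeC23
          | by rewrite edgeC23 edgeC12 | by rewrite edgeC12 edgeC23 edgeC12].
case/and4P; rewrite inE => h1 h2 h3 h4.
have [a [b [c [abc e]]]] : exists a b c, edge E a b c /\
    [set p; q; r] = [set inl (inl a); inl (inr b); inr c].
  case: p q r h1 h2 h3 h4 => [[x|x]|x] [[y|y]|y] [[z|z]|z] //= _ _ _ h.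
  - by exists x, y, z.
  - exists x, z, y; rewrite edgeC23; split=> //.
    by apply/setP => u; rewrite !inE; do 3!case: (u == _).
  - exists y, x, z; rewrite edgeC12; split=> //.
    by apply/setP => u; rewrite !inE; do 3!case: (u == _).
  - exists z, x, y; rewrite edgeC12 edgeC23; split=> //.
    by apply/setP => u; rewrite !inE; do 3!case: (u == _).
  - exists y, z, x; rewrite edgeC23 edgeC12; split=> //.
    by apply/setP => u; rewrite !inE; do 3!case: (u == _).
  - exists z, y, x; rewrite edgeC12 edgeC23 edgeC12; split=> //.
    by apply/setP => u; rewrite !inE; do 3!case: (u == _).
by apply/existsP; exists a; apply/existsP; exists b; apply/existsP; exists c;
  rewrite -/(edge E a b c) abc e eqxx.
Qed.

Lemma mem_kU (K : nat) (i j : 'I_K) (B : {set 'I_K}) :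
  ([set inr j; inl (inl i); inl (inr B)] \in kU K) = (i \in B).
Proof.
rewrite inE; apply/existsP/idP => [[j' /existsP[i' /existsP[B' /andP[iB /eqP e]]]]|iB].
  have : inl (inl i) \in [set inr j'; inl (inl i'); inl (inr B')].
    by rewrite -e !inE eqxx orbT.
  have : inl (inr B) \in [set inr j'; inl (inl i'); inl (inr B')].
    by rewrite -e !inE eqxx orbT.
  by case/setUP => [/set2P[]|/set1P[->]] // /setUP[/set2P[|[->]]|/set1P].
by exists j; apply/existsP; exists i; apply/existsP; exists B; rewrite /U_rel iB eqxx.
Qed.

(* Every [c_j] and [a_i] lies in an edge with [b_[K]], so all the [a_i] are on
   one side of the tripartition of Trip(H), and likewise the [b_S] and [c_j]. *)
Lemma in_Trip_kU (H : prop3) (K : nat) : 0 < K -> in_Trip H (kU K) ->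
  exists (V : finType) (E : {set {set V}}) (a : 'I_K -> V) (b : {set 'I_K} -> V) (c : 'I_K -> V),
  [/\ H V E, injective a, injective c, {in [pred B | B != set0] &, injective b} &
      forall i B j, B != set0 -> edge E (a i) (b B) (c j) = (i \in B)].
Proof.
move=> K_gt0 [V [E [f [HE [fi kUE]]]]].
have trip i (B : {set 'I_K}) j : (i \in B) = ([set f (inr j); f (inl (inl i)); f (inl (inr B))] \in trip_graph E).
  by rewrite -(mem_kU i j B) kUE inE !imsetU !imset_set1.
pose sa i := side (f (inl (inl i))); pose sb (B : {set 'I_K}) := side (f (inl (inr B))); pose sc j := side (f (inr j)).
have distinct i (B : {set 'I_K}) j : i \in B -> [/\ sc j != sa i, sc j != sb B & sa i != sb B].
  by rewrite (trip i B j) mem_trip_graph => /and4P[].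
have i0 : 'I_K by exists 0.
have lt3 := @side_lt3 V.
have sbT : [/\ sc i0 != sa i0, sc i0 != sb setT & sa i0 != sb setT] by apply: distinct; rewrite inE.
have saE i : sa i = sa i0.
  have [] := distinct i setT i0 (in_setT _); case: sbT.
  have := lt3 (f (inl (inl i))); have := lt3 (f (inl (inl i0))).
  have := lt3 (f (inl (inr setT))); have := lt3 (f (inr i0)).
  rewrite -/(sa i) -/(sa i0) -/(sb setT) -/(sc i0); lia.
have scE j : sc j = sc i0.
  have [] := distinct i0 setT j (in_setT _); case: sbT.
  have := lt3 (f (inl (inl i0))); have := lt3 (f (inr j)).
  have := lt3 (f (inl (inr setT))); have := lt3 (f (inr i0)).
  rewrite -/(sc j) -/(sa i0) -/(sb setT) -/(sc i0); lia.
(* The vertex [b_set0] is isolated, so its side is undetermined; this is the origin of the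
   restriction to nonempty [B]. *)
have sbE B : B != set0 -> sb B = sb setT.
  case/set0Pn => i iB; have [] := distinct i B i0 iB; case: sbT; rewrite saE.
  have := lt3 (f (inl (inl i0))); have := lt3 (f (inl (inr B))).
  have := lt3 (f (inl (inr setT))); have := lt3 (f (inr i0)).
  rewrite -/(sb B) -/(sa i0) -/(sb setT) -/(sc i0); lia.
exists V, E, (fun i => proj (f (inl (inl i)))), (fun B => proj (f (inl (inr B)))),
  (fun j => proj (f (inr j))); split=> //.
- move=> i i' /side_proj_inj h; have := h _; rewrite -/(sa i) -/(sa i') !saE.
  by move=> /(_ erefl)/fi[].
- move=> j j' /side_proj_inj h; have := h _; rewrite -/(sc j) -/(sc j') !scE.
  by move=> /(_ erefl)/fi[].
- move=> B B'; rewrite !inE => Bn B'n /side_proj_inj h; have := h _.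
  by rewrite -/(sb B) -/(sb B') !sbE // => /(_ erefl)/fi[].
move=> i B j Bn; rewrite (trip i B j) mem_trip_graph.
rewrite -/(sa i) -/(sc j) -/(sb B) saE scE sbE //; case: sbT => -> -> -> /=.
by rewrite [LHS]edgeC23 [LHS]edgeC12.
Qed.

Lemma edge_pullback (V W : finType) (f : W -> V) (E : {set {set V}}) x y z :
  edge (pullback f E) x y z = edge E (f x) (f y) (f z).
Proof. by rewrite /edge inE !imsetU !imset_set1. Qed.

(* A vertex [t] on the right is encoded by its neighbourhood together with a
   private element, which makes the encoding injective. *)
Lemma bipartite_in_Trip (H : prop3) (T : finType) (G : T -> T -> bool) :
  hereditary H -> (forall k : nat, 1 <= k -> in_Trip H (kU k)) -> 0 < #|T| ->
  exists (V : finType) (E : {set {set V}}) (al be ga : T -> V),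
  [/\ H V E, injective al, injective be, injective ga & #|V| <= 3 * #|T| /\
      forall t u w, edge E (al t) (be u) (ga w) = G t u].
Proof.
move=> [_ hered] allk T_gt0; pose K := #|{: T * bool}|.
have K_gt0 : 0 < K by rewrite /K card_prod card_bool muln_gt0 T_gt0.
have [V0 [E0 [a [b [c [HE ai ci bi abc]]]]]] := in_Trip_kU K_gt0 (allk K K_gt0).
(* The index [(t, true)] stands for the left vertex [t] and [(u, false)] is the private element of
   [u], which also makes [S u] nonempty as [in_Trip_kU] requires. *)
pose S u : {set 'I_K} := [set i | let p := enum_val i in if p.2 then G p.1 u else p.1 == u].
have memS p u : (enum_rank p \in S u) = if p.2 then G p.1 u else p.1 == u.
  by rewrite inE /= enum_rankK.
have Sne u : S u != set0.
  by apply/set0Pn; exists (enum_rank (u, false)); rewrite memS /= eqxx.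
pose al0 t := a (enum_rank (t, true)); pose be0 u := b (S u).
pose ga0 t := c (enum_rank (t, false)).
(* Discarding all other vertices makes [#|V|] at most [3 * #|T|], so that each block keeps a
   definite share of the vertices. *)
pose A : {set V0} := (al0 @: setT :|: be0 @: setT) :|: ga0 @: setT.
have alA t : al0 t \in A by rewrite !inE imset_f.
have beA t : be0 t \in A by rewrite !inE imset_f ?orbT.
have gaA t : ga0 t \in A by rewrite !inE imset_f ?orbT.
pose V : finType := {v : V0 | v \in A}.
pose mk (v : V0) (vA : v \in A) : V := exist _ v vA.
exists V, (pullback val E0), (fun t => mk _ (alA t)), (fun t => mk _ (beA t)),
  (fun t => mk _ (gaA t)); split.
- by apply: hered HE; exact: val_inj.
- by move=> t u /(congr1 val) /= /ai/enum_rank_inj[].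
- move=> t u /(congr1 val) /= /bi; rewrite !inE !Sne => /(_ isT isT)/setP/(_ (enum_rank (t, false))).
  by rewrite !memS /= eqxx => /esym/eqP.
- by move=> t u /(congr1 val) /= /ci/enum_rank_inj[].
split=> [|t u w]; last by rewrite edge_pullback /= abc // memS.
rewrite card_sig; apply: leq_trans (_ : #|A| <= _); first by apply: subset_leq_card; apply/subsetP.
rewrite (_ : 3 = 1 + 1 + 1) // !mulnDl mul1n.
apply: leq_trans (leq_card_setU _ _) _; apply: leq_add; last by rewrite -cardsT leq_imset_card.
apply: leq_trans (leq_card_setU _ _) _; by apply: leq_add; rewrite -cardsT leq_imset_card.
Qed.

(** * The chain of blocks *)

Lemma card_residue (k N : nat) (r : 'I_k) : k %| N ->
  k * #|[set u : 'I_N | u %% k == r]| = N.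
Proof.
case/dvdnP => q ->; have k_gt0 : 0 < k by apply: leq_ltn_trans (ltn_ord r).
have lt (j : 'I_q) : j * k + r < q * k.
  by apply: leq_trans (_ : j.+1 * k <= _); rewrite ?leq_mul // mulSn addnC ltn_add2r.
pose f j := Ordinal (lt j).
have fi : injective f.
  move=> j j' /(congr1 val) /= /addIn/eqP; rewrite eqn_pmul2r // => /eqP; exact: val_inj.
suff -> : [set u : 'I_(q * k) | u %% k == r] = f @: setT.
  by rewrite card_imset // cardsT card_ord mulnC.
apply/setP => u; rewrite inE; apply/eqP/imsetP => [ur|[j _ ->]] /=.
  have uq : u %/ k < q by rewrite ltn_divLR.
  by exists (Ordinal uq) => //; apply: val_inj; rewrite /= -ur -divn_eq.
by rewrite modnMDl modn_small.
Qed.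

Lemma impure_trivial (X T : finType) (c : X -> T) (psi : X -> 'I_1) v : impure c psi v = false.
Proof.
apply/negbTE; rewrite /impure -ltnNge /impurity (_ : [set p | _] = set0).
  by rewrite cards0 muln0 expn_gt0 card_fib_gt0.
by apply/setP => p; rewrite !inE !ord1 eqxx !andbF.
Qed.

(* At least half of the vertices lie in a part at least half of which has their
   own value of [psi], so that part has at most [2 N / k] vertices of the block. *)
Lemma card_parts_ge (V : finType) (P : {set {set V}}) (N k : nat) (x : 'I_N -> V)
    (psi : 'I_N -> 'I_k) : 0 < N -> partition P [set: V] ->
  (forall i, k * #|[set u | psi u == i]| = N) ->
  128 * #|[set u | impure (pblock P \o x) psi u]| <= N ->
  k <= 4 * #|P|.
Proof.
move=> N_gt0 /and3P[/eqP cov triv _] bal imp; set c := pblock P \o x.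
pose R := [set u | ~~ minority c psi u].
have RN : N <= 2 * #|R|.
  have := card_minority c psi; rewrite card_ord => h1.
  have : #|~: R| <= #|[set u | minority c psi u && ~~ impure c psi u]| + #|[set u | impure c psi u]|.
    apply: leq_trans (leq_card_setU _ _); apply: subset_leq_card; apply/subsetP => u.
    by rewrite !inE negbK => ->; case: impure.
  have := cardsC R; rewrite card_ord; move: imp h1; rewrite -/c; lia.
have cls Z : Z \in P -> k * #|[set u in R | c u == Z]| <= 2 * N.
  move=> _; have [->|[u]] := set_0Vmem [set u in R | c u == Z]; first by rewrite cards0 muln0.
  rewrite !inE => /andP[nmi /eqP cu]; rewrite /minority -leqNgt in nmi.
  apply: leq_trans (_ : k * #|fib c u| <= _).
    rewrite leq_mul //; apply: subset_leq_card; apply/subsetP => w.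
    by rewrite !inE cu => /andP[].
  have fE : #|fib c u| = #|[set w in fib c u | psi w == psi u]| + #|[set w in fib c u | psi w != psi u]|.
    rewrite -(cardsID [set w | psi w == psi u]); congr (_ + _); apply: eq_card => w.
      by rewrite !inE.
    by rewrite !inE andbC.
  have le2 : #|fib c u| <= 2 * #|[set w | psi w == psi u]|.
    apply: leq_trans (_ : 2 * #|[set w in fib c u | psi w == psi u]| <= _).
      by move: nmi; rewrite fE !mul2n -!addnn leq_add2r leq_add2l.
    by rewrite leq_mul //; apply: subset_leq_card; apply/subsetP => w; rewrite !inE => /andP[].
  by apply: leq_trans (leq_mul (leqnn k) le2) _; rewrite mulnCA bal.
have RE : #|R| = \sum_(Z in P) #|[set u in R | c u == Z]|.
  rewrite double_count -sum1_card big_mkcond; apply: eq_bigr => u _.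
  have [uR|uR] := boolP (u \in R).
    rewrite (_ : [set Z in P | _] = [set c u]) ?cards1 //.
    apply/setP => Z; rewrite !inE eq_sym; apply/andb_idl => /eqP ->.
    by rewrite /c /= pblock_mem // cov inE.
  apply/esym/eqP; rewrite cards_eq0 -subset0; apply/subsetP => Z;
    by move: uR; rewrite !inE negbK andbF.
rewrite -(leq_pmul2r N_gt0); apply: leq_trans (leq_mul (leqnn k) RN) _.
rewrite mulnCA RE -[4]/(2 * 2) -!mulnA leq_mul // big_distrr mulnCA -sum_nat_const /=.
exact: leq_sum.
Qed.

Definition code_size (n : nat) : nat := projT1 (cid (exists_code n)).

Definition code_word (n : nat) : 'I_(code_size n) -> {set 'I_n} :=
  projT1 (cid (projT2 (cid (exists_code n)))).

Lemma code_wordP (n : nat) :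
  [/\ forall u v, u != v -> n <= 8 * hamming (@code_word n u) (@code_word n v),
      2 ^ (3 * n) <= code_size n ^ 8 & n <= 8 -> code_size n = 2 ^ n].
Proof. exact: projT2 (cid (projT2 (cid (exists_code n)))). Qed.

Fixpoint chain_size (i : nat) : nat := if i is j.+1 then code_size (chain_size j) else 1.

Lemma code_size_ge (m n : nat) : 8 * m <= 3 * n -> 2 ^ m <= code_size n.
Proof.
move=> mn; have [_ h _] := code_wordP n.
rewrite -(@leq_exp2r _ _ 8) // -expnM; apply: leq_trans h.
by rewrite leq_exp2l // mulnC.
Qed.

Lemma chain_size_gt0 i : 0 < chain_size i.
Proof. by case: i => // i; apply: leq_trans (@code_size_ge 0 _ _). Qed.

(** The factor 3 beats the rate 3/8 of the codes, since [3 * 3 / 8 > 1]: once [Tw i] is at least 16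
    the surplus in the exponent is two bits, enough to restore the factor. *)
Lemma chain_size_ge i : 4 <= i -> 3 * Tw i <= chain_size i.
Proof.
have small n : n <= 8 -> code_size n = 2 ^ n by have [_ _ h] := code_wordP n.
have c3 : chain_size 3 = 16 by rewrite /= !small.
elim: i => // i IH; rewrite leq_eqVlt => /orP[/eqP[<-]|i4].
  rewrite -[chain_size 4]/(code_size (chain_size 3)) c3.
  by apply: leq_trans (@code_size_ge 6 16 _).
have {}IH := IH i4; have Tw16 : 16 <= Tw i.
  case: i i4 {IH} => [|[|[|[|i]]]] // _; elim: i => // i IH.
  by apply: leq_trans IH _; rewrite [leqRHS]/= ltnW // ltn_expl.
rewrite -[chain_size i.+1]/(code_size (chain_size i)).
apply: leq_trans (@code_size_ge (Tw i).+2 _ _); last by lia.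
have -> : Tw i.+1 = 2 ^ Tw i by case: i {IH Tw16} i4.
by rewrite !expnS mulnA leq_mul.
Qed.

Section Chain.
Variables (s Q : nat).

(** Divisible by every [chain_size i] with [i <= s], so that residues are exactly balanced
    colourings; [Q] makes the graph as large as desired. *)
Definition block_size : nat := Q * \prod_(i < s.+1) chain_size i.

Definition colour (i : nat) (u : 'I_block_size) : 'I_(chain_size i) :=
  Ordinal (ltn_pmod u (chain_size_gt0 i)).

(** Both orders are provided for because consecutive blocks alternate between the left and the right
    side of the bipartite graph. *)
Definition chain_graph (p q : 'I_s.+1 * 'I_block_size) : bool :=
  if p.1 < q.1 then colour p.1 p.2 \in @code_word (chain_size p.1) (colour p.1.+1 q.2)
  else colour q.1 q.2 \in @code_word (chain_size q.1) (colour q.1.+1 p.2).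

Lemma colour_balanced i (r : 'I_(chain_size i)) : i <= s ->
  chain_size i * #|[set u | colour i u == r]| = block_size.
Proof.
move=> i_s; rewrite -[RHS](@card_residue (chain_size i) _ r); last first.
  rewrite /block_size (bigD1 (Ordinal (i_s : i < s.+1))) //= mulnCA dvdn_mulr //.
by congr (_ * _); apply: eq_card => u; rewrite !inE.
Qed.

(** Even blocks are taken on the left and odd ones on the right, so consecutive blocks face each
    other. There are three sides with [s.+1] blocks each, whence [r = 3 * s.+1]. Block 0 has a
    single class and is pure; [impure_step] carries purity to block [s], where [card_parts_ge]
    counts the parts. *)
Lemma chain_lower (H : prop3) (eps : RR) (M : nat) :
  hereditary H -> (forall k : nat, 1 <= k -> in_Trip H (kU k)) ->
  (0 < eps)%R -> (eps * (2%:R ^+ 20 * (3 * s.+1)%N%:R ^+ 3) <= 1)%R ->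
  (forall (V : finType) (E : {set {set V}}), H V E -> Q <= #|V| ->
     exists P, eps_regular_partition E eps P /\ #|P| <= M) -> 0 < Q ->
  chain_size s <= 4 * M.
Proof.
move=> hH allk e0 es reg Q_gt0.
have prod_gt0 : 0 < \prod_(i < s.+1) chain_size i.
  by apply: prodn_gt0 => i; exact: chain_size_gt0.
have N_gt0 : 0 < block_size by rewrite muln_gt0 Q_gt0.
have T_gt0 : 0 < #|{: 'I_s.+1 * 'I_block_size}|.
  by rewrite card_prod !card_ord muln_gt0 N_gt0.
have [V [E [al [be [ga [HE ali bei gai [cV edgeE]]]]]]] :=
  bipartite_in_Trip chain_graph hH allk T_gt0.
rewrite card_prod !card_ord in cV.
pose x i u := if odd i then be (inord i, u) else al (inord i, u).
have xi i : injective (x i).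
  by rewrite /x; case: odd => u v; [move/bei => []|move/ali => []].
have VN : block_size <= #|V|.
  by rewrite -[X in X <= _]card_ord -(card_imset _ (xi 0)) max_card.
have [P [Preg PM]] : exists P, eps_regular_partition E eps P /\ #|P| <= M.
  by apply: reg HE _; apply: leq_trans VN; rewrite leq_pmulr.
have edge_x i u w z : i < s -> edge E (x i u) (x i.+1 w) (ga z) =
    (colour i u \in @code_word (chain_size i) (colour i.+1 w)).
  move=> i_s; rewrite /x /=; case: (odd i) => /=; rewrite ?[in LHS](edgeC12 E (be _)) edgeE.
    by rewrite /chain_graph /= !inordK ?ltnS ?(ltnW i_s) // ltnNge leqnSn.
  by rewrite /chain_graph /= !inordK ?ltnS ?(ltnW i_s) // leqnn.
have pure i : i <= s -> 128 * #|[set u | impure (pblock P \o x i) (colour i) u]| <= block_size.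
  elim: i => [|i IH] i_s.
    rewrite (_ : [set u | _] = set0) ?cards0 ?muln0 //.
    by apply/setP => u; rewrite !inE; apply: impure_trivial.
  rewrite -[leqRHS]card_ord.
  have [dist _ _] := code_wordP (chain_size i).
  apply: (@impure_step V E eps P (3 * s.+1) e0 es Preg _ _ _ (x i) (x i.+1) ga
            (xi i) (xi i.+1) gai _ _ _ _ _ _ (colour i) (colour i.+1)
            (@code_word (chain_size i)) dist _ _ _).
  - by rewrite card_ord -mulnA.
  - by rewrite card_ord -mulnA.
  - rewrite card_prod !card_ord; apply: leq_trans cV _; rewrite -mulnA leq_mul //.
    by rewrite leq_mul // leq_pmull.
  - exact: leq_trans VN.
  - by move=> r; rewrite card_ord colour_balanced // ltnW.
  - by move=> u w z; apply: edge_x.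
  - by rewrite card_ord IH // ltnW.
apply: leq_trans (_ : 4 * #|P| <= _); last by rewrite leq_mul.
apply: card_parts_ge N_gt0 _ _ (pure s (leqnn s)); first by case/andP: Preg.
by move=> r; exact: colour_balanced.
Qed.
End Chain.

Lemma reg_bound_lower (H : prop3) (eps : RR) (s M : nat) :
  hereditary H -> (forall k : nat, 1 <= k -> in_Trip H (kU k)) -> 4 <= s ->
  (0 < eps)%R -> (eps * (2%:R ^+ 20 * (3 * s.+2)%N%:R ^+ 3) <= 1)%R ->
  reg_bound H eps M -> Tw s <= M.
Proof.
move=> hH allk s4 e0 es [n0 n0P].
(* The additional block pays for the factor 4: [Tw s.+1] is at least twice [Tw s], so
   [6 * Tw s <= 4 * M]. *)
have h : chain_size s.+1 <= 4 * M.
  apply: (@chain_lower s.+1 n0.+1 H eps) => // V E HE nV.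
  by apply: n0P HE _; exact: ltnW.
have := leq_trans (chain_size_ge (leqW s4)) h.
have -> : Tw s.+1 = 2 ^ Tw s by case: s s4 {es h}.
have : 2 * Tw s <= 2 ^ Tw s.
  case: (Tw s) => // t; rewrite expnS leq_mul // ltn_expl //.
lia.
Qed.

(** * Growth rates *)

Local Open Scope ring_scope.

Lemma Tw_mono (i j : nat) : (i <= j)%N -> (Tw i <= Tw j)%N.
Proof.
elim: j => [|j IH]; first by rewrite leqn0 => /eqP ->.
rewrite leq_eqVlt => /orP[/eqP -> //|/IH h]; apply: leq_trans h _.
by case: j {IH} => // j; rewrite [leqRHS]/= ltnW // ltn_expl.
Qed.

(** About [eps ^ -6] refinements exhaust the energy, and [4 + 2 * j <= 8 * eps ^ -6 <= eps ^ -7]. *)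
Lemma reg_bound_upper (H : prop3) (eps : RR) : 0 < eps -> eps < 8%:R^-1 ->
  reg_bound H eps (TwR (powR eps (- 7%:R))).
Proof.
move=> e0 e8; have ie : 8%:R <= eps^-1 by rewrite -[leLHS]invrK lef_pV2 ?posrE ?invr_gt0 // ltW.
have aE : powR eps (- 7%:R) = eps^-1 * eps ^- 6.
  by rewrite powRN powR_mulrn ?ltW // exprS invfM.
have b1 : 1 <= eps ^- 6 by rewrite -exprVn exprn_ege1 //; lra.
set b := eps ^- 6 in aE b1; pose j := (Num.truncn b).+1.
have jb : b < j%:R by exact: truncnS_gt.
have bj : j%:R <= b + 1.
  by rewrite -natr1 lerD2r truncn_le; lra.
have e6 : 0 < eps ^+ 6 by rewrite exprn_gt0.
have [|n0 n0P] := @reg_bound_Tw H eps j e0.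
  have : b * eps ^+ 6 = 1 by rewrite /b mulVf // gt_eqF.
  by move=> be; rewrite -[ltLHS]be ltr_pM2r.
exists n0 => V E HE nV; have [P [Preg PT]] := n0P V E HE nV; exists P; split=> //.
apply: leq_trans PT _; apply: Tw_mono; rewrite truncn_ge_nat ?powR_ge0 //.
rewrite aE natrD natrM; nra.
Qed.

Lemma tower_growth (H : prop3) : hereditary H ->
  (forall k : nat, (1 <= k)%N -> in_Trip H (kU k)) ->
    exists C C' : RR, 0 < C /\ 0 < C' /\
    exists eps0 : RR, 0 < eps0 /\
    forall eps : RR, 0 < eps -> eps < eps0 ->
      exists m : nat, is_MH H eps m /\
        (TwR (powR eps (- C)) <= m)%N /\ (m <= TwR (powR eps (- C')))%N.
Proof.
(* With [d = eps ^ (-1/4)] and [3 * s.+2 <= 6 * d], the condition of [reg_bound_lower] follows from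
   [2 ^ 20 * 216 <= d], guaranteed by [2 ^ 28 < d]. *)
move=> hH allk; exists 4%:R^-1, 7%:R; split; first by rewrite invr_gt0.
split=> //; pose b : RR := 2%:R ^+ 28.
have b8 : 8%:R <= b by rewrite /b (exprD _ 3 25); have := exprn_ege1 25 (ler1n RR 2); rewrite !exprS expr0; lra.
have b0 : 0 < b by lra.
exists (b^-1 ^+ 4); split; first by rewrite exprn_gt0 // invr_gt0.
move=> eps e0 eb; pose d := powR eps (- 4%:R^-1).
have d0 : 0 < d by rewrite powR_gt0.
have dE : d ^+ 4 = eps^-1.
  rewrite -(powR_inv1 (ltW e0)) -powR_mulrn ?powR_ge0 // -powRrM.
  by rewrite mulNr mulVf // pnatr_eq0.
have bd : b < d.
  rewrite ltNge; apply/negP => db; move: eb; rewrite ltNge exprVn => /negP; apply.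
  by rewrite -[leRHS]invrK -dE lef_pV2 ?posrE ?exprn_gt0 // lerXn2r // nnegrE ltW.
have e8 : eps < 8%:R^-1.
  apply: lt_le_trans eb _; rewrite exprVn lef_pV2 ?posrE ?exprn_gt0 //.
  by rewrite (le_trans b8) // -[leLHS]expr1; apply: ler_weXn2l => //; lra.
have upper := reg_bound_upper H e0 e8.
have [m [hm mle mmin]] := ex_least upper.
exists m; split=> //; split=> //.
rewrite /TwR -/d; set s := Num.truncn d.
have sd : s%:R <= d by rewrite truncn_le ltW.
apply: (reg_bound_lower hH allk _ e0 _ hm).
  by rewrite truncn_ge_nat ?ltW //; lra.
have s2 : (3 * s.+2)%N%:R <= 6%:R * d :> RR.
  by rewrite natrM -addn2 natrD; lra.
have s3 : (3 * s.+2)%N%:R ^+ 3 <= (6%:R * d) ^+ 3 :> RR.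
  have d6 : 0 <= 6%:R * d by lra.
  by rewrite lerXn2r ?nnegrE.
have c20 : 0 < 2%:R ^+ 20 :> RR by rewrite exprn_gt0.
apply: le_trans (_ : eps * (2%:R ^+ 20 * (6%:R * d) ^+ 3) <= _).
  by rewrite ler_pM2l // ler_pM2l.
have -> : eps = d ^- 4 by rewrite dE invrK.
have -> : d ^- 4 * (2%:R ^+ 20 * (6%:R * d) ^+ 3) = (2%:R ^+ 20 * 216%:R) / d.
  move: c20; move: (2%:R ^+ 20) => c _; field; rewrite gt_eqF //.
rewrite ler_pdivrMr // mul1r; apply: le_trans (ltW bd).
rewrite /b (exprD _ 20 8) ler_pM2l // -natrX ler_nat.
by [].
Qed.

Theorem theorem5p5 (H : prop3) (hH : hereditary H) :
  ((forall k : nat, (1 <= k)%N -> in_Trip H (kU k)) ->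
    exists C C' : RR, 0 < C /\ 0 < C' /\
    exists eps0 : RR, 0 < eps0 /\
    forall eps : RR, 0 < eps -> eps < eps0 ->
      exists m : nat, is_MH H eps m /\
        (TwR (powR eps (- C)) <= m)%N /\ (m <= TwR (powR eps (- C')))%N)
  /\
  ((exists k : nat, (1 <= k)%N /\ ~ in_Trip H (kU k)) ->
    MHhom_defined H /\
    exists K : RR, 0 < K /\
    exists eps0 : RR, 0 < eps0 /\
    forall eps : RR, 0 < eps -> eps < eps0 ->
      exists m mh : nat, is_MH H eps m /\ is_MHhom H (eps ^+ 4) mh /\
        (m <= mh)%N /\
        mh%:R <= powR 2 (powR 2 (powR eps (- K)))).
Proof.
split; first exact: tower_growth hH.
exact: homogeneous_growth.
Qed.
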